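(* Let $\emptyset\neq F\subseteq[0,1]$ be a closed set with every portion of positive measure and let $E$ be a relatively residual subset of $F$. Let $\gamma\colon[0,1]\to(0,1)^d$ be a Lipschitz curve with Lipschitz constant $1$ such that $\gamma$ is differentiable with $\|\gamma'(t)\|=1$ at each $t\in E$. Then the set $S$ of those $f\in\operatorname{Lip}_1([0,1]^d)$ for which there exists $t\in E$ such that $f$ is differentiable at $\gamma(t)$ with derivative of norm one is residual in $\operatorname{Lip}_1([0,1]^d)$.
   Context: $\operatorname{Lip}_{1}([0,1]^{d})$ denotes the set of all functions $f\colon[0,1]^d\to\mathbb{R}$ with Lipschitz constant at most $1$, viewed as a complete metric space with the supremum metric. A set $F\subseteq\mathbb{R}$ has every portion of positive measure if for every open $U\subseteq\mathbb{R}$ with $U\cap F\neq\emptyset$ the Lebesgue (outer) measure of $U\cap F$ is positive. A Lipschitz curve is a Lipschitz map $\gamma\colon I\to\mathbb{R}^d$, $I$ a closed interval, whose derivative is bounded away from zero in norm almost everywhere. *)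

(* Defs.v *)
From HB Require Import structures.
From mathcomp Require Import all_boot all_order all_algebra.
From mathcomp Require Import all_classical all_reals all_analysis.
Unset Printing Implicit Defensive.
Import Order.TTheory GRing.Theory Num.Theory.
Import numFieldTopology.Exports numFieldNormedType.Exports.
Local Open Scope classical_set_scope.
Local Open Scope ring_scope.

Definition enorm {R : realType} {d : nat} (v : 'I_d -> R) : R :=
  Num.sqrt (\sum_(i < d) v i ^+ 2).

Definition cube {R : realType} (d : nat) : set ('I_d -> R) :=
  [set x | forall i, 0 <= x i <= 1].
Definition ocube {R : realType} (d : nat) : set ('I_d -> R) :=
  [set x | forall i, 0 < x i < 1].

Definition Lip1 {R : realType} (d : nat) : set (('I_d -> R) -> R) :=
  [set f | forall x y, cube d x -> cube d y ->
     `|f x - f y| <= enorm (fun i => x i - y i)].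

(* Ball of radius r around f for the supremum metric on [0,1]^d:
   sup_{x in [0,1]^d} |f x - g x| < r. *)
Definition sup_ball {R : realType} (d : nat) (f : ('I_d -> R) -> R) (r : R)
  (g : ('I_d -> R) -> R) : Prop :=
  exists r', r' < r /\ forall x, cube d x -> `|f x - g x| <= r'.

Definition R_ball {R : realType} (x : R) (r : R) (y : R) : Prop := `|x - y| < r.

(* Topology of the (pseudo)metric subspace X given by balls B. *)
Definition open_in {R : realType} {T : Type} (B : T -> R -> T -> Prop)
  (X U : set T) : Prop :=
  forall x, X x -> U x -> exists2 r : R, 0 < r & forall y, X y -> B x r y -> U y.
Definition dense_in {R : realType} {T : Type} (B : T -> R -> T -> Prop)
  (X U : set T) : Prop :=
  forall x, X x -> forall r : R, 0 < r -> exists y, [/\ X y, U y & B x r y].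

Definition residual_in {R : realType} {T : Type} (B : T -> R -> T -> Prop)
  (X S : set T) : Prop :=
  exists U : nat -> set T,
    [/\ forall n, open_in B X (U n),
        forall n, dense_in B X (U n) &
        forall x, X x -> (forall n, U n x) -> S x].

(* gamma : [0,1] -> R^d has derivative v at t in [0,1] (relative to [0,1],
   i.e. one-sided at the endpoints). *)
Definition curve_deriv {R : realType} {d : nat} (gamma : R -> 'I_d -> R)
  (t : R) (v : 'I_d -> R) : Prop :=
  forall eps : R, 0 < eps -> exists2 delta : R, 0 < delta &
    forall s, 0 <= s <= 1 -> `|s - t| < delta ->
      enorm (fun i => gamma s i - gamma t i - (s - t) * v i) <= eps * `|s - t|.

Definition fun_deriv {R : realType} {d : nat} (f : ('I_d -> R) -> R)
  (p g : 'I_d -> R) : Prop :=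
  forall eps : R, 0 < eps -> exists2 delta : R, 0 < delta &
    forall h : 'I_d -> R, enorm h < delta ->
      `|f (fun i => p i + h i) - f p - \sum_(i < d) g i * h i| <= eps * enorm h.

(* Lipschitz curve on [0,1] in the sense of the paper: Lipschitz, with
   derivative bounded away from zero in norm almost everywhere on [0,1]. *)
Definition lipschitz_curve {R : realType} {d : nat} (gamma : R -> 'I_d -> R) : Prop :=
  (exists L : R, forall s t, 0 <= s <= 1 -> 0 <= t <= 1 ->
      enorm (fun i => gamma s i - gamma t i) <= L * `|s - t|) /\
  (exists2 c : R, 0 < c &
     {ae (@lebesgue_measure R), forall t : R, 0 <= t <= 1 ->
        exists2 v, curve_deriv gamma t v & c <= enorm v}).

Definition every_portion_pos {R : realType} (F : set R) : Prop :=
  forall U : set R, open U -> U `&` F !=set0 ->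
    (0 < (@lebesgue_measure R) (U `&` F))%E.

(* Main.v *)
(* Write [defect y = y - f (gamma y)], a nondecreasing function of [y].  At an
   interior point [t] where [defect' = 0] and [gamma' = v] is a unit vector, a
   1-Lipschitz [f] is differentiable at [gamma t] with gradient [v]; so it suffices
   that a typical [f] has such a [t] in [E].  Such a [t] is the intersection of
   nested intervals [I_n] around which [f \o gamma] has slope close to one.

   If [defect] grows by at most [e * |I|] on [I], then, by a Vitali covering
   argument, it has difference quotients at most [lambda] at all points of [I]
   outside a set of measure [6 e |I| / lambda], hence at some [t] of [F] when [F]
   has density bounded below in [I].  Near such a [t], Baire category provides a
   portion of [F], inside the next dense open set, on which [gamma] uniformly
   almost preserves lengths; there one takes a density point [s] of [F] and
   replaces [f] by its truncation by cones with apexes on [gamma] near [gamma s].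
   This moves [f] arbitrarily little, makes the slope still closer to one on a tiny
   interval around [s], and preserves it at all larger scales.

   Since the intervals have rational endpoints, asking for every interval [I] that
   [f] be steep on a refinement of [I], or else away from the functions steep on
   [I], is a countable family of dense open conditions. *)
Require Import Defs.
From HB Require Import structures.
From mathcomp Require Import all_boot all_order all_algebra.
From mathcomp Require Import all_classical all_reals all_analysis.
From mathcomp Require Import measurable_realfun lra ring.
Import Order.TTheory GRing.Theory Num.Theory.
Import numFieldTopology.Exports numFieldNormedType.Exports.
Local Open Scope classical_set_scope.
Local Open Scope ring_scope.

Set Implicit Arguments.
Unset Strict Implicit.

(** * The Euclidean norm and distance *)

Section Euclidean.
Context {R : realType} {d : nat}.
Implicit Types (x y z v : 'I_d -> R).

Lemma enorm_ge0 x : 0 <= enorm x.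
Proof. exact: sqrtr_ge0. Qed.

Lemma enorm_sqr x : enorm x ^+ 2 = \sum_(i < d) x i ^+ 2.
Proof. by rewrite sqr_sqrtr// sumr_ge0// => i _; exact: sqr_ge0. Qed.

Lemma enormN x : enorm (fun i => - x i) = enorm x.
Proof. by congr Num.sqrt; apply: eq_bigr => i _; rewrite sqrrN. Qed.

Lemma enorm0 : enorm (fun _ : 'I_d => 0 : R) = 0.
Proof. by rewrite /enorm big1 ?sqrtr0// => i _; rewrite expr0n. Qed.

Lemma enormZ (a : R) x : enorm (fun i => a * x i) = `|a| * enorm x.
Proof.
rewrite /enorm -sqrtr_sqr -sqrtrM ?sqr_ge0// mulr_sumr.
by congr Num.sqrt; apply: eq_bigr => i _; rewrite exprMn.
Qed.

Lemma ler_coord_enorm x i : `|x i| <= enorm x.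
Proof.
rewrite -sqrtr_sqr ler_wsqrtr// (bigD1 i)//= lerDl.
by rewrite sumr_ge0// => j _; exact: sqr_ge0.
Qed.

Lemma enorm_le x (a : R) : 0 <= a -> enorm x ^+ 2 <= a ^+ 2 -> enorm x <= a.
Proof. by move=> a0; rewrite ler_pXn2r// ?nnegrE// enorm_ge0. Qed.

Lemma enorm_sqrD x y :
  enorm (fun i => x i + y i) ^+ 2 =
  enorm x ^+ 2 + enorm y ^+ 2 + 2 * \sum_(i < d) x i * y i.
Proof.
rewrite !enorm_sqr mulr_sumr -!big_split/=.
by apply: eq_bigr => i _; ring.
Qed.

Lemma Cauchy_Schwarz_enorm x y : \sum_(i < d) x i * y i <= enorm x * enorm y.
Proof.
have [A0|A0] := eqVneq (enorm x) 0.
  rewrite A0 mul0r big1// => i _.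
  have := ler_coord_enorm x i; rewrite A0 normr_le0 => /eqP ->.
  by rewrite mul0r.
have [B0|B0] := eqVneq (enorm y) 0.
  rewrite B0 mulr0 big1// => i _.
  have := ler_coord_enorm y i; rewrite B0 normr_le0 => /eqP ->.
  by rewrite mulr0.
have Ap : 0 < enorm x by rewrite lt_neqAle eq_sym A0 enorm_ge0.
have Bp : 0 < enorm y by rewrite lt_neqAle eq_sym B0 enorm_ge0.
(* Once expanded, this square is [2 |x| |y| (|x| |y| - S)]. *)
have := sqr_ge0 (enorm (fun i => (- enorm y) * x i + enorm x * y i)).
rewrite enorm_sqrD !enormZ !exprMn !real_normK ?num_real//.
under eq_bigr do rewrite mulrACA.
rewrite -mulr_sumr; set S := \sum_(_ < _) _ => h.
have : 0 <= (enorm x * enorm y) * (enorm x * enorm y - S) by lra.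
by rewrite pmulr_rge0 ?mulr_gt0// subr_ge0.
Qed.

Lemma ler_enormD x y : enorm (fun i => x i + y i) <= enorm x + enorm y.
Proof.
apply: enorm_le; first by rewrite addr_ge0// enorm_ge0.
by rewrite enorm_sqrD; have := Cauchy_Schwarz_enorm x y; nra.
Qed.

Definition edist x y := enorm (fun i => x i - y i).

Lemma edist_ge0 x y : 0 <= edist x y.
Proof. exact: enorm_ge0. Qed.

Lemma edistxx x : edist x x = 0.
Proof.
rewrite /edist -enorm0; congr enorm; apply/funext => i; exact: subrr.
Qed.

Lemma edistC x y : edist x y = edist y x.
Proof.
rewrite /edist -enormN; congr enorm; apply/funext => i; exact: opprB.
Qed.

Lemma edist_triangle y x z : edist x z <= edist x y + edist y z.
Proof.
have := ler_enormD (fun i => x i - y i) (fun i => y i - z i).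
by under [X in enorm X]funext do rewrite subrKA.
Qed.

(* The square root is concave: [sqrt (T^2 + w) <= T + w / (2 T)]. *)
Lemma enorm_subZ_le (h v : 'I_d -> R) (T : R) : 0 < T -> enorm v = 1 ->
  enorm (fun i => h i - T * v i) <=
  T - \sum_(i < d) v i * h i + enorm h ^+ 2 / (2 * T).
Proof.
move=> T0 v1.
have CS : \sum_(i < d) v i * h i <= enorm h.
  by have := Cauchy_Schwarz_enorm v h; rewrite v1 mul1r.
have E : (enorm h ^+ 2 / (2 * T)) * (2 * T) = enorm h ^+ 2.
  by rewrite divfK// mulf_neq0// gt_eqF.
set q := enorm h ^+ 2 / (2 * T) in E *.
have q0 : 0 <= q by rewrite divr_ge0 ?sqr_ge0// mulr_ge0// ltW.
have N : enorm (fun i => h i - T * v i) ^+ 2 =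
    enorm h ^+ 2 + T ^+ 2 - 2 * T * \sum_(i < d) v i * h i.
  have -> : enorm (fun i => h i - T * v i) =
      enorm (fun i => h i + (- T) * v i).
    by congr enorm; apply/funext => i; rewrite mulNr.
  rewrite enorm_sqrD enormZ v1 mulr1 normrN real_normK ?num_real//.
  under eq_bigr do rewrite mulrCA.
  rewrite -mulr_sumr (_ : \sum_(i < d) h i * v i = \sum_(i < d) v i * h i).
    by ring.
  by apply: eq_bigr => i _; rewrite mulrC.
set S := \sum_(i < d) v i * h i in CS N *.
(* After multiplication by [2 T], Cauchy-Schwarz bounds this below by [(|h| - T)^2 + T^2]. *)
have A : 0 <= T - S + q.
  have : 0 <= (2 * T) * (T - S + q).
    have -> : (2 * T) * (T - S + q) =
      enorm h ^+ 2 + 2 * T * T - 2 * T * S by rewrite -E; ring.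
    have : T * S <= T * enorm h by rewrite ler_pM2l.
    by have := sqr_ge0 (enorm h - T); have := sqr_ge0 T; nra.
  by rewrite pmulr_rge0// mulr_gt0.
apply: enorm_le => //.
(* As [|h|^2 = 2 T q], the two squares differ by exactly [(q - S)^2]. *)
by rewrite N -E; have := sqr_ge0 (q - S); lra.
Qed.

End Euclidean.

(** * One-Lipschitz functions on the cube *)

Section LipschitzFunctions.
Context {R : realType} {d : nat}.
Implicit Types (f g : ('I_d -> R) -> R) (x y p : 'I_d -> R).

Lemma ocube_cube x : ocube d x -> cube d x.
Proof. by move=> Ox i; have /andP[? ?] := Ox i; rewrite !ltW. Qed.

Lemma ocube_nbhs p : ocube d p -> exists2 r : R, 0 < r &
  forall h, enorm h < r -> cube d (fun i => p i + h i).
Proof.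
(* The distance from [p] to the faces of the cube, capped by [1], which is also its value for
   [d = 0]. *)
move=> Op; exists (\big[Num.min/1]_(i < d) Num.min (p i) (1 - p i)).
  apply: lt_bigmin => // i _; have /andP[? ?] := Op i.
  by rewrite lt_min subr_gt0; apply/andP.
move=> h hr i.
have : `|h i| < Num.min (p i) (1 - p i).
  apply: le_lt_trans (ler_coord_enorm h i) _.
  exact: lt_le_trans hr (bigmin_le _ _ _).
by rewrite lt_min !ltr_norml => /andP[/andP[? ?] /andP[? ?]]; apply/andP; split; lra.
Qed.

Lemma Lip1N f : Lip1 d f -> Lip1 d (fun x => - f x).
Proof. by move=> Lf x y Cx Cy; rewrite -opprD normrN; exact: Lf. Qed.

Lemma Lip1_le f x y : Lip1 d f -> cube d x -> cube d y ->
  f x <= f y + edist x y.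
Proof.
by move=> Lf Cx Cy; have := Lf x y Cx Cy; rewrite ler_norml => /andP[_]; rewrite lerBlDl.
Qed.

Lemma Lip1P f : (forall x y, cube d x -> cube d y -> f x <= f y + edist x y) ->
  Lip1 d f.
Proof.
move=> H x y Cx Cy; have := H x y Cx Cy; have := H y x Cy Cx.
rewrite (edistC y x) /edist ler_norml => A B; apply/andP; split; lra.
Qed.

Lemma Lip1_max f g : Lip1 d f -> Lip1 d g ->
  Lip1 d (fun x => Num.max (f x) (g x)).
Proof.
move=> Lf Lg; apply: Lip1P => x y Cx Cy.
have := Lip1_le Lf Cx Cy; have := Lip1_le Lg Cx Cy.
have : f y <= Num.max (f y) (g y) by rewrite le_max lexx.
have : g y <= Num.max (f y) (g y) by rewrite le_max lexx orbT.
by rewrite ge_max => *; apply/andP; split; lra.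
Qed.

Lemma Lip1_sup (I : set R) (k : R -> ('I_d -> R) -> R) :
  I !=set0 -> (forall u, I u -> Lip1 d (k u)) ->
  (forall x, cube d x -> has_ubound [set k u x | u in I]) ->
  Lip1 d (fun x => sup [set k u x | u in I]).
Proof.
move=> [u0 Iu0] Lk bk; apply: Lip1P => x y Cx Cy.
apply: ge_sup; first by exists (k u0 x), u0.
move=> _ [u Iu <-]; apply: le_trans (Lip1_le (Lk u Iu) Cx Cy) _.
by rewrite lerD2r; apply: ub_le_sup; [exact: bk|exists u].
Qed.

End LipschitzFunctions.

(** * Modifying a one-Lipschitz function along a curve *)

Section Curves.
Context {R : realType} {d : nat}.
Implicit Types (gamma : R -> 'I_d -> R) (f g : ('I_d -> R) -> R) (t y e : R).

Definition defect gamma f y : R := y - f (gamma y).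

(** Only speed at most one is recorded here; speed exactly one is required on [E] alone, by
    [setting_deriv]. *)
Definition unit_speed_curve gamma :=
  (forall t, 0 <= t <= 1 -> ocube d (gamma t)) /\
  (forall s t, 0 <= s <= 1 -> 0 <= t <= 1 ->
     edist (gamma s) (gamma t) <= `|s - t|).

(** A form of [|gamma'(t)| = 1] that mentions only lengths of chords. The chords straddle [t], so
    that a chord that is too short can be stretched to straddle nearby points as well. *)
Definition almost_straight gamma t tau e := forall x y : R,
  0 <= x -> x <= t -> t <= y -> y <= 1 -> t - x < tau -> y - t < tau ->
  (1 - e) * (y - x) <= edist (gamma y) (gamma x).

Lemma defect_mono gamma f s t : unit_speed_curve gamma -> Lip1 d f ->
  0 <= s -> s <= t -> t <= 1 ->
  0 <= defect gamma f t - defect gamma f s <= 2 * (t - s).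
Proof.
move=> [Og Lg] Lf s0 st t1.
have sI : 0 <= s <= 1 by rewrite s0 (le_trans st).
have tI : 0 <= t <= 1 by rewrite t1 (le_trans s0).
have := Lf _ _ (ocube_cube (Og t tI)) (ocube_cube (Og s sI)).
have := Lg t s tI sI; rewrite /defect /edist.
rewrite [X in _ <= X -> _]ger0_norm ?subr_ge0// => A B.
move: (le_trans B A); rewrite ler_norml => /andP[? ?].
by apply/andP; split; lra.
Qed.

Lemma defect_dist_le gamma f s t : unit_speed_curve gamma -> Lip1 d f ->
  0 <= s <= 1 -> 0 <= t <= 1 ->
  `|defect gamma f t - defect gamma f s| <= 2 * `|t - s|.
Proof.
move=> Ug Lf; wlog st : s t / s <= t.
  move=> H sI tI; have [st|/ltW ts] := leP s t; first exact: H.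
  by rewrite distrC [X in _ <= 2 * X]distrC; exact: H.
move=> /andP[s0 _] /andP[_ t1].
have /andP[A B] := defect_mono Ug Lf s0 st t1.
by rewrite ger0_norm// ger0_norm// subr_ge0.
Qed.

(** Reversing time and changing the sign of [f] exchanges raising [f] ahead of [t] with lowering it
    behind [t]. *)
Lemma unit_speed_rev gamma : unit_speed_curve gamma ->
  unit_speed_curve (fun u => gamma (1 - u)).
Proof.
move=> [Og Lg]; split=> [t tI|s t sI tI].
  by apply: Og; apply/andP; split; lra.
apply: le_trans (Lg _ _ _ _) _; try by apply/andP; split; lra.
by rewrite (_ : 1 - s - (1 - t) = - (s - t)) ?normrN//; ring.
Qed.

Lemma almost_straight_rev gamma t tau e : almost_straight gamma t tau e ->
  almost_straight (fun u => gamma (1 - u)) (1 - t) tau e.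
Proof.
move=> H x y x0 xt ty y1 tx yt.
have := H (1 - y) (1 - x); rewrite edistC.
rewrite (_ : 1 - x - (1 - y) = y - x); last by ring.
by apply; lra.
Qed.

(* Taking the maximum of [f] with the cones of slope one with apexes
   [gamma u], [t <= u <= t + rho], at heights [f (gamma t) + (1 - e) (u - t)]. *)
Lemma raise_along_curve gamma f t tau rho e :
  unit_speed_curve gamma -> Lip1 d f -> 0 <= t <= 1 ->
  0 < rho -> rho < tau -> 0 <= e -> almost_straight gamma t tau e ->
  exists g, [/\ Lip1 d g,
    forall x, cube d x -> f x <= g x <= f x + 2 * rho,
    g (gamma t) = f (gamma t),
    forall y, t <= y -> y <= 1 -> y - t <= rho ->
      f (gamma t) + (1 - e) * (y - t) <= g (gamma y) &
    forall y, 0 <= y -> y <= t -> t - y < tau ->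
      g (gamma y) <= Num.max (f (gamma y)) (f (gamma t) - (1 - e) * (t - y))].
Proof.
move=> [Og Lg] Lf /andP[t0 t1] rho0 rhot e0 Sg.
pose I := [set u : R | t <= u <= 1 /\ u - t <= rho].
pose k u x := f (gamma t) + (1 - e) * (u - t) - edist x (gamma u).
have Cg u : 0 <= u -> u <= 1 -> cube d (gamma u).
  by move=> u0 u1; apply: ocube_cube; apply: Og; rewrite u0.
have It : I t by split; [rewrite lexx|rewrite subrr ltW].
(* One [rho] comes from the height of the apex, the other from the distance between [gamma t] and
   [gamma u]. *)
have kle x u : cube d x -> I u -> k u x <= f x + 2 * rho.
  move=> Cx [/andP[tu u1] ur]; rewrite /k.
  have u0 := le_trans t0 tu.
  have A := Lip1_le Lf (Cg t t0 t1) Cx.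
  have B := edist_triangle (gamma u) (gamma t) x.
  have := Lg t u; rewrite t0 t1 u0 u1 => /(_ isT isT).
  rewrite distrC ger0_norm ?subr_ge0// => D.
  have : 0 <= e * (u - t) by rewrite mulr_ge0// subr_ge0.
  by rewrite (edistC x); lra.
have bk x : cube d x -> has_ubound [set k u x | u in I].
  by move=> Cx; exists (f x + 2 * rho) => _ [u Iu <-]; exact: kle.
pose K x := sup [set k u x | u in I].
have LK : Lip1 d K.
  apply: Lip1_sup => //; first by exists t.
  move=> u Iu; apply: Lip1P => x y Cx Cy; rewrite /k.
  by have := edist_triangle x y (gamma u); rewrite (edistC y x); lra.
have Kle x b : (forall u, I u -> k u x <= b) -> K x <= b.
  move=> H; apply: ge_sup; first by exists (k t x), t.
  by move=> _ [u Iu <-]; exact: H.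
have leK x u : cube d x -> I u -> k u x <= K x.
  by move=> Cx Iu; apply: ub_le_sup; [exact: bk|exists u].
(* Seen from [gamma y] behind [t], the apex [gamma u] is at distance at least [(1 - e) (u - y)],
   which cancels its height gain [(1 - e) (u - t)]. *)
have Kback y : 0 <= y -> y <= t -> t - y < tau ->
    K (gamma y) <= f (gamma t) - (1 - e) * (t - y).
  move=> y0 yt ytau; apply: Kle => u [/andP[tu u1] ur]; rewrite /k edistC.
  have := Sg y u y0 yt tu u1 ytau (le_lt_trans ur rhot).
  by rewrite (_ : u - y = (u - t) + (t - y)); [lra|ring].
exists (fun x => Num.max (f x) (K x)); split.
- exact: Lip1_max.
- move=> x Cx; rewrite le_max lexx ge_max/=; apply/andP; split; first lra.
  by apply: Kle => u; exact: kle.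
- apply/max_idPl; have := Kback t t0 (lexx t).
  by rewrite subrr mulr0 subr0; apply; exact: lt_trans rhot.
- move=> y ty y1 yr; rewrite le_max; apply/orP; right.
  have := leK (gamma y) y (Cg y (le_trans t0 ty) y1).
  rewrite /k edistxx subr0; apply; split => //; exact/andP.
- move=> y y0 yt ytau; rewrite ge_max le_max lexx/=.
  by rewrite le_max (Kback y)// orbT.
Qed.

(** Raise [f] ahead of [t], then treat the opposite of the result in the same way along the reversed
    curve, which lowers it behind [t]. On the side where a move could spoil the slope, it pushes no
    value past the line of slope [1 - e] through the value at [t]; hence a bound [kappa >= e]
    survives at distances below [tau]. *)
Lemma straighten_along_curve gamma f t tau rho e :
  unit_speed_curve gamma -> Lip1 d f -> 0 <= t <= 1 ->
  0 < rho -> rho < tau -> 0 <= e -> almost_straight gamma t tau e ->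
  exists g, [/\ Lip1 d g,
    forall x, cube d x -> `|f x - g x| <= 2 * rho,
    g (gamma t) = f (gamma t),
    forall y, 0 <= y <= 1 -> `|y - t| <= rho ->
      `|defect gamma g y - defect gamma g t| <= e * `|y - t| &
    forall kappa y, e <= kappa -> 0 <= y <= 1 -> `|y - t| < tau ->
      `|defect gamma f y - defect gamma f t| <= kappa * `|y - t| ->
      `|defect gamma g y - defect gamma g t| <= kappa * `|y - t|].
Proof.
move=> Ug Lf tI rho0 rhot e0 Sg; have /andP[t0 t1] := tI.
have [g1 [L1 f1 e1 up1 dn1]] := raise_along_curve Ug Lf tI rho0 rhot e0 Sg.
have tI' : 0 <= 1 - t <= 1 by apply/andP; split; lra.
have [g2 [L2 f2 e2 up2 dn2]] := raise_along_curve (unit_speed_rev Ug) (Lip1N L1)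
  tI' rho0 rhot e0 (almost_straight_rev Sg).
rewrite !subKr in e2 up2 dn2.
have {}up2 y : 0 <= y -> y <= t -> t - y <= rho ->
    - g2 (gamma y) <= f (gamma t) - (1 - e) * (t - y).
  move=> y0 yt yr; have := up2 (1 - y).
  rewrite !subKr e1 (_ : 1 - y - (1 - t) = t - y); last by ring.
  by move=> H; have := H _ _ yr; rewrite -lerN2; lra.
have {}dn2 y : t <= y -> y <= 1 -> y - t < tau ->
    Num.min (g1 (gamma y)) (f (gamma t) + (1 - e) * (y - t)) <= - g2 (gamma y).
  move=> ty y1 yr; have := dn2 (1 - y).
  rewrite !subKr e1 (_ : 1 - t - (1 - y) = y - t); last by ring.
  move=> H; rewrite lerNr oppr_min; apply: le_trans (H _ _ yr) _; try lra.
  by rewrite ge_max !le_max lexx/=; apply/orP; right; lra.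
have Lg2 : Lip1 d (fun x => - g2 x) by exact: Lip1N.
exists (fun x => - g2 x).
have eg : - g2 (gamma t) = f (gamma t) by rewrite e2 opprK.
(* The defect is nondecreasing, so on each side of [t] a one-sided bound on the values suffices. *)
have red kappa y : 0 <= y <= 1 ->
    (t <= y -> f (gamma t) + (1 - kappa) * (y - t) <= - g2 (gamma y)) ->
    (y <= t -> - g2 (gamma y) <= f (gamma t) - (1 - kappa) * (t - y)) ->
    `|defect gamma (fun x => - g2 x) y - defect gamma (fun x => - g2 x) t|
      <= kappa * `|y - t|.
  move=> /andP[y0 y1] A B; have [ty|/ltW yt] := leP t y.
    have /andP[? _] := defect_mono Ug Lg2 t0 ty y1.
    rewrite ger0_norm// ger0_norm ?subr_ge0//.
    by have := A ty; rewrite /defect eg; lra.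
  have /andP[? _] := defect_mono Ug Lg2 y0 yt t1.
  rewrite distrC ger0_norm// distrC ger0_norm ?subr_ge0//.
  by have := B yt; rewrite /defect eg; lra.
split => //.
- move=> x Cx; have /andP[a b] := f1 x Cx; have /andP[a' b'] := f2 x Cx.
  by rewrite ler_norml; apply/andP; split; lra.
- move=> y yI yr; have /andP[y0 y1] := yI; apply: red => // [ty|yt].
    rewrite ger0_norm ?subr_ge0// in yr.
    apply: le_trans (dn2 y ty y1 (le_lt_trans yr rhot)).
    by rewrite le_min lexx andbT; exact: up1.
  rewrite distrC ger0_norm ?subr_ge0// in yr.
  exact: up2.
- move=> kappa y ek yI yr; have /andP[y0 y1] := yI => D; apply: red => // [ty|yt].
    rewrite ger0_norm ?subr_ge0// in yr.
    apply: le_trans (dn2 y ty y1 yr).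
    have /andP[g1f _] := f1 _ (ocube_cube (Ug.1 y yI)).
    have : 0 <= (kappa - e) * (y - t) by rewrite mulr_ge0// subr_ge0.
    move: D; rewrite [X in _ <= _ * X]ger0_norm ?subr_ge0// /defect ler_norml.
    by move=> /andP[_ D] E; rewrite le_min; apply/andP; split; lra.
  rewrite distrC ger0_norm ?subr_ge0// in yr.
  have yg : - g2 (gamma y) <= g1 (gamma y).
    by have /andP[] := f2 _ (ocube_cube (Ug.1 y yI)); lra.
  apply: le_trans yg _; apply: le_trans (dn1 y y0 yt yr) _.
  have : 0 <= (kappa - e) * (t - y) by rewrite mulr_ge0// subr_ge0.
  move: D; rewrite distrC [X in _ <= _ * X]distrC [X in _ <= _ * X]ger0_norm ?subr_ge0//.
  rewrite /defect ler_norml => /andP[_ D] E; rewrite ge_max; apply/andP; split; lra.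
Qed.

End Curves.

(** * Nested intervals and Baire category in a closed subset of the line *)

Section NestedIntervals.
Context {R : realType}.
Implicit Types (F : set R) (a b l : nat -> R).

Lemma halving_small l (e : R) : (forall n, l n.+1 <= l n / 2) -> 0 < e ->
  exists n, l n < e.
Proof.
move=> H e0; have A n : l n * 2 ^+ n <= l 0%N.
  elim: n => [|n IH]; first by rewrite expr0 mulr1.
  have : 0 < 2 ^+ n :> R by rewrite exprn_gt0.
  by rewrite exprS; have := H n; nra.
have [l0|l0] := ltP (l 0%N) e; first by exists 0%N.
pose n := Num.bound (l 0%N / e).
have nP : l 0%N / e < n%:R.
  by apply: archi_boundP; rewrite divr_ge0// ltW// (lt_le_trans e0).
exists n; rewrite ltNge; apply/negP => en.
have : n%:R <= 2 ^+ n :> R by rewrite -natrX ler_nat ltnW// ltn_expl.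
have := A n; rewrite ltr_pdivrMr// in nP.
by have : 0 <= n%:R :> R; [exact: ler0n|nra].
Qed.

(** The limit is the supremum of the left endpoints; it lies in [F] as a limit of points of [F] in
    the intervals. *)
Lemma nested_intervals F a b : closed F ->
  (forall n, a n <= a n.+1) -> (forall n, b n.+1 <= b n) ->
  (forall n, exists2 u, F u & a n <= u <= b n) ->
  (forall e, 0 < e -> exists n, b n - a n < e) ->
  exists2 t, F t & forall n, a n <= t <= b n.
Proof.
move=> cF ha hb Fab small.
have aM m n : (m <= n)%N -> a m <= a n.
  by move=> mn; exact: (homo_leq (@lexx _ R) (@le_trans _ R) ha).
have bM m n : (m <= n)%N -> b n <= b m.
  elim: n => [|n IH]; first by rewrite leqn0 => /eqP ->.
  rewrite leq_eqVlt => /orP[/eqP -> //|]; rewrite ltnS => /IH.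
  exact: le_trans (hb n).
have ab m n : a m <= b n.
  have [u _ /andP[au ub]] := Fab (maxn m n).
  apply: le_trans (aM _ _ (leq_maxl m n)) _.
  apply: le_trans (le_trans au ub) _; exact: bM (leq_maxr m n).
pose t := sup (range a).
have tab n : a n <= t <= b n.
  apply/andP; split.
    by apply: ub_le_sup; [exists (b n) => _ [m _ <-]|exists n].
  by apply: ge_sup; [exists (a 0%N), 0%N|move=> _ [m _ <-]].
exists t => //; apply: cF => B /nbhs_ballP[e /= e0 teB].
have [n abn] := small e e0; have [u Fu /andP[au ub]] := Fab n.
exists u; split => //; apply: teB; rewrite /ball/=.
by have /andP[? ?] := tab n; rewrite ltr_norml; apply/andP; split; lra.
Qed.

(** Baire's theorem in [F], localized: density of the [V n] is only known within [xi] of [t0]. The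
    proof nests closed balls centred in [F], with radii at least halved at each step. *)
Lemma closed_Baire F (V : nat -> set R) (t0 xi : R) : closed F ->
  F t0 -> 0 < xi -> (forall n, open_in (@R_ball R) F (V n)) ->
  (forall n t r, F t -> `|t0 - t| < xi -> 0 < r ->
     exists y, [/\ F y, V n y & `|t - y| < r]) ->
  exists2 t, F t & forall n, V n t.
Proof.
move=> cF Ft0 xi0 oV dV.
pose inv (s : R * R) := [/\ F s.1, 0 < s.2 & `|t0 - s.1| + s.2 < xi].
pose step n (s s' : R * R) := [/\ `|s.1 - s'.1| + s'.2 <= s.2, s'.2 <= s.2 / 2 &
  forall y, F y -> `|s'.1 - y| <= s'.2 -> V n y].
have ex (ns : nat * (R * R)) : exists s', inv ns.2 -> inv s' /\ step ns.1 ns.2 s'.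
  case: ns => n [t r] /=.
  case: (pselect (inv (t, r))) => [[/= Ft r0 tr]|ni]; last by exists (t, r).
  have h2 : 0 < r / 2 by rewrite divr_gt0.
  have tx : `|t0 - t| < xi by lra.
  have [y [Fy Vy ty]] := dV n t (r / 2) Ft tx h2.
  have [q q0 qV] := oV n y Fy Vy.
  (* Half of [q] makes the closed ball fit into the open ball of radius [q]; half of [r] keeps it
     inside the previous ball. *)
  have m0 : 0 < Num.min (q / 2) (r / 2) by rewrite lt_min h2 divr_gt0.
  have mq : Num.min (q / 2) (r / 2) <= q / 2 by rewrite ge_min lexx.
  have mr : Num.min (q / 2) (r / 2) <= r / 2 by rewrite ge_min lexx orbT.
  exists (y, Num.min (q / 2) (r / 2)) => _; split; split => //=.
  - by have := ler_distD t t0 y; lra.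
  - by lra.
  - by move=> z Fz yz; apply: qV => //; rewrite /R_ball; lra.
have [nx nxP] := choice ex.
pose s := fix s n := if n is m.+1 then nx (m, s m) else (t0, xi / 2).
have si n : inv (s n).
  elim: n => [|n IH /=]; last by have [] := nxP (n, s n) IH.
  by split => //=; rewrite ?subrr ?normr0; lra.
have st n : step n (s n) (s n.+1) by have [] := nxP (n, s n) (si n).
pose a n := (s n).1 - (s n).2; pose b n := (s n).1 + (s n).2.
have [||||t Ft tP] := nested_intervals (a := a) (b := b) cF.
- move=> n; have [+ _ _] := st n; rewrite /a; set u := (s n); set w := (s n.+1).
  by have := ler_norm (u.1 - w.1); lra.
- move=> n; have [+ _ _] := st n; rewrite /b; set u := (s n); set w := (s n.+1).
  by have := ler_norm (w.1 - u.1); rewrite distrC; lra.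
- move=> n; have [Fs s0 _] := si n; exists (s n).1 => //.
  by rewrite /a /b; apply/andP; split; lra.
- move=> e e0; apply: (halving_small (l := fun n => b n - a n)) => // n.
  by have [_ + _] := st n; rewrite /a /b; lra.
exists t => // n; have [_ _ H] := st n; apply: H => //.
have := tP n.+1; rewrite /a /b => /andP[? ?].
by rewrite ler_norml; apply/andP; split; lra.
Qed.

End NestedIntervals.

(** * Consequences of a unit derivative of the curve *)

Section CurveDerivative.
Context {R : realType} {d : nat}.
Implicit Types (gamma : R -> 'I_d -> R) (f : ('I_d -> R) -> R) (v : 'I_d -> R).

(** The increments of [gamma] from [t] to [y] and to [x] are multiples of [v] up to [e (y - t)] and
    [e (t - x)], and these errors add up to [e (y - x)]. *)
Lemma almost_straight_curve_deriv gamma (t e : R) v :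
  curve_deriv gamma t v -> enorm v = 1 -> 0 <= t <= 1 -> 0 < e ->
  exists2 tau, 0 < tau & almost_straight gamma t tau e.
Proof.
move=> Dg v1 /andP[t0 t1] e0; have [tau tau0 H] := Dg e e0; exists tau => //.
move=> x y x0 xt ty y1 tx yt.
have Hx : `|x - t| = t - x by rewrite distrC ger0_norm// subr_ge0.
have Hy : `|y - t| = y - t by rewrite ger0_norm// subr_ge0.
have := H x; rewrite x0 (le_trans xt t1) Hx => /(_ isT tx).
have := H y; rewrite y1 (le_trans t0 ty) Hy => /(_ isT yt).
set A := (fun i => gamma y i - gamma t i - _); set B := (fun i => gamma x i - _ - _).
move=> HA HB.
have : enorm (fun i => (y - x) * v i) <=
    edist (gamma y) (gamma x) + (enorm A + enorm B).
  rewrite -(enormN A); apply: le_trans (lerD (lexx _) (ler_enormD _ _)).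
  apply: le_trans (ler_enormD _ _).
  rewrite le_eqVlt; apply/orP; left; apply/eqP; congr enorm.
  by apply/funext => i; rewrite /A /B; ring.
by rewrite enormZ v1 mulr1 ger0_norm; lra.
Qed.

(** If the chord over [[x, y]] is too short by [q], stretching it at each end by less than [q / 3]
    to reach a nearby [s] lengthens it by less than [q], as [gamma] is one-Lipschitz. *)
Lemma not_almost_straight_open gamma F (tau e : R) : unit_speed_curve gamma ->
  F `<=` `[0, 1] -> 0 <= e <= 1 ->
  open_in (@R_ball R) F (fun t => ~ almost_straight gamma t tau e).
Proof.
move=> [_ Lg] F01 /andP[e0 e1] t Ft /existsNP[x /existsNP[y]].
do 6 (case/not_implyP => ?); move/negP; rewrite -ltNge => lt.
have t01 : 0 <= t <= 1 by have := F01 t Ft; rewrite /= in_itv.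
pose q := (1 - e) * (y - x) - edist (gamma y) (gamma x).
have q0 : 0 < q by rewrite subr_gt0.
pose r := Num.min (q / 3) (Num.min (tau - (t - x)) (tau - (y - t))).
exists r; first by rewrite !lt_min divr_gt0//=; apply/andP; split; lra.
move=> s Fs; rewrite /R_ball !lt_min => /and3P[].
have := F01 s Fs; rewrite /= in_itv/= => /andP[s0 s1].
rewrite !ltr_norml => /andP[? ?] /andP[? ?] /andP[? ?] As.
pose x' := Num.min x s; pose y' := Num.max y s.
have x's : x' <= s by rewrite ge_min lexx orbT.
have x'x : x' <= x by rewrite ge_min lexx.
have sy' : s <= y' by rewrite le_max lexx orbT.
have yy' : y <= y' by rewrite le_max lexx.
have x'0 : 0 <= x' by rewrite le_min; apply/andP; split; lra.
have y'1 : y' <= 1 by rewrite ge_max; apply/andP; split; lra.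
have xx' : x - x' < q / 3 by rewrite /x'; have [?|?] := leP x s; lra.
have y'y : y' - y < q / 3 by rewrite /y'; have [?|?] := leP s y; lra.
have sx' : s - x' < tau by rewrite /x'; have [?|?] := leP x s; lra.
have y's : y' - s < tau by rewrite /y'; have [?|?] := leP s y; lra.
have := As x' y' x'0 x's sy' y'1 sx' y's.
have Ly : edist (gamma y') (gamma y) <= y' - y.
  rewrite -[leRHS]ger0_norm ?subr_ge0//.
  by apply: Lg; apply/andP; split; lra.
have Lx : edist (gamma x) (gamma x') <= x - x'.
  rewrite -[leRHS]ger0_norm ?subr_ge0//.
  by apply: Lg; apply/andP; split; lra.
have := edist_triangle (gamma y) (gamma y') (gamma x').
have := edist_triangle (gamma x) (gamma y) (gamma x').
have : (1 - e) * (y - x) <= (1 - e) * (y' - x').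
  by apply: ler_wpM2l; [|lra]; rewrite subr_ge0.
by rewrite /q in xx' y'y q0 *; lra.
Qed.

(* Baire category makes the almost straightness of [gamma] at the points of [E]
   locally uniform on a portion of [F]. *)
Lemma almost_straight_portion gamma (F E : set R) (t0 xi e : R) :
  unit_speed_curve gamma -> closed F -> F `<=` `[0, 1] ->
  residual_in (@R_ball R) F E ->
  (forall t, E t -> exists2 v, curve_deriv gamma t v & enorm v = 1) ->
  F t0 -> 0 < xi -> 0 < e <= 1 ->
  exists t1 delta tau, [/\ F t1, `|t0 - t1| < xi, 0 < delta, 0 < tau &
    forall t, F t -> `|t1 - t| < delta -> almost_straight gamma t tau e].
Proof.
move=> Ug cF F01 [G [oG dG GE]] Eg Ft0 xi0 /andP[e0 e1].
apply: contrapT => noP.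
have e01 : 0 <= e <= 1 by rewrite ltW.
(* Without such a portion, failure at scale [1 / (n + 1)] is dense in [F] near [t0] for every [n]. A
   point common to all [G n] and all [N n] lies in [E], where differentiability excludes failure at
   all scales. *)
pose N n := [set t | ~ almost_straight gamma t (n.+1%:R^-1) e].
have oN n : open_in (@R_ball R) F (N n) by exact: not_almost_straight_open.
have [||t Ft Vt] := closed_Baire (V := fun n => G n `&` N n) cF Ft0 xi0.
- move=> n t Ft [Gt Nt]; have [r1 r10 H1] := oG n t Ft Gt.
  have [r2 r20 H2] := oN n t Ft Nt; exists (Num.min r1 r2).
    by rewrite lt_min r10.
  move=> y Fy; rewrite /R_ball lt_min => /andP[? ?].
  by split; [exact: H1|exact: H2].
- move=> n t r Ft tx r0.
  have r20 : 0 < r / 2 by rewrite divr_gt0.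
  have [y [Fy ty Ny]] : exists y, [/\ F y, `|t - y| < r / 2 & N n y].
    apply: contrapT => no; apply: noP; exists t, (r / 2), (n.+1%:R^-1).
    split => // y Fy ty; apply: contrapT => ny; apply: no; exists y; split => //.
  have [q q0 qN] := oN n y Fy Ny.
  have m0 : 0 < Num.min q (r / 2) by rewrite lt_min q0.
  have [z [Fz Gz]] := dG n y Fy _ m0.
  rewrite /R_ball lt_min => /andP[yq yr].
  exists z; split => //; first by split => //; exact: qN.
  by have := ler_distD y t z; lra.
have Et : E t by apply: GE => // n; have [] := Vt n.
have [v Dv v1] := Eg t Et.
have t01 : 0 <= t <= 1 by have := F01 t Ft; rewrite /= in_itv.
have [tau tau0 At] := almost_straight_curve_deriv Dv v1 t01 e0.
pose n := Num.bound tau^-1.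
have nP : tau^-1 < n%:R by apply: archi_boundP; rewrite invr_ge0 ltW.
have ntau : n.+1%:R^-1 <= tau.
  rewrite -[leRHS]invrK lef_pV2 ?posrE ?invr_gt0//.
  by apply: le_trans (ltW nP) _; rewrite ler_nat.
have [_] := Vt n; apply=> x y x0 xt ty y1 tx yt.
by apply: At => //; exact: lt_le_trans ntau.
Qed.

(* Comparing [f (gamma t + h)] with the values of [f] at [gamma (t + T)] and
   [gamma (t - T)] for [T] much larger than the length of [h]. *)
Lemma fun_deriv_of_curve gamma f (t : R) v : unit_speed_curve gamma ->
  Lip1 d f -> 0 < t < 1 -> curve_deriv gamma t v -> enorm v = 1 ->
  (forall e, 0 < e -> exists2 delta, 0 < delta & forall s, 0 <= s <= 1 ->
     `|s - t| < delta ->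
     `|defect gamma f s - defect gamma f t| <= e * `|s - t|) ->
  fun_deriv f (gamma t) v.
Proof.
move=> [Og _] Lf /andP[t0 t1] Dg v1 Df e e0.
have t01 : 0 <= t <= 1 by rewrite !ltW.
have [r0 r00 rC] := ocube_nbhs (Og t t01).
(* With [T = |h| / e], the quadratic term [|h|^2 / (2 T)] is [e |h| / 2]; the errors of the curve
   and of the defect are [mu T = e |h| / 4] each. They sum to [e |h|]. *)
pose mu := e ^+ 2 / 4.
have mu0 : 0 < mu by rewrite divr_gt0 ?exprn_gt0.
have [d1 d10 Hf] := Df mu mu0; have [d2 d20 Hg] := Dg mu mu0.
pose m := Num.min (Num.min d1 d2) (Num.min t (1 - t)).
have m0 : 0 < m by rewrite !lt_min d10 d20 t0 subr_gt0.
exists (Num.min r0 (e * m)); first by rewrite lt_min r00 mulr_gt0.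
move=> h; rewrite lt_min => /andP[hr hm].
have Cp := ocube_cube (Og t t01).
have Ch := rC h hr.
have [h0|hn] := eqVneq (enorm h) 0.
  have hi i : h i = 0.
    by have := ler_coord_enorm h i; rewrite h0 normr_le0 => /eqP.
  rewrite big1 => [|i _]; last by rewrite hi mulr0.
  rewrite (_ : (fun i => gamma t i + h i) = gamma t); last first.
    by apply/funext => i; rewrite hi addr0.
  by rewrite subrr subr0 normr0 mulr_ge0 ?enorm_ge0// ltW.
have hp : 0 < enorm h by rewrite lt_neqAle eq_sym hn enorm_ge0.
pose T := enorm h / e.
have T0 : 0 < T by rewrite divr_gt0.
have hT : enorm h = e * T by rewrite /T mulrC divfK// gt_eqF.
have Tm : T < m by rewrite /T ltr_pdivrMr// mulrC.
move: Tm; rewrite !lt_min => /andP[/andP[T1 T2] /andP[Tt T1t]].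
set S := \sum_(i < d) _.
have quad : enorm h ^+ 2 / (2 * T) = e / 2 * enorm h.
  by rewrite hT; field; rewrite gt_eqF.
have muT : mu * T = e / 4 * enorm h by rewrite hT /mu; field.
have pT : 0 <= t + T <= 1 by apply/andP; split; lra.
have mT : 0 <= t - T <= 1 by apply/andP; split; lra.
have np : `|t + T - t| = T by rewrite addrC addKr ger0_norm// ltW.
have nm : `|t - T - t| = T by rewrite addrAC subrr add0r normrN ger0_norm// ltW.
have fp := Hf (t + T) pT; rewrite np in fp; move: (fp T1) => {fp}.
have fm := Hf (t - T) mT; rewrite nm in fm; move: (fm T1) => {fm}.
have gp := Hg (t + T) pT; rewrite np in gp; move: (gp T2) => {gp}.
have gm := Hg (t - T) mT; rewrite nm in gm; move: (gm T2) => {gm}.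
rewrite /defect !ler_norml => gm gp /andP[fm _] /andP[_ fp].
have Dp : edist (gamma (t + T)) (fun i => gamma t i + h i) <=
    mu * T + enorm (fun i => h i - T * v i).
  apply: le_trans (lerD gp (lexx _)); rewrite -(enormN (fun i => h i - _)).
  apply: le_trans (ler_enormD _ _).
  rewrite le_eqVlt; apply/orP; left; apply/eqP; congr enorm.
  by apply/funext => i; ring.
have Dm : edist (fun i => gamma t i + h i) (gamma (t - T)) <=
    mu * T + enorm (fun i => - h i - T * v i).
  apply: le_trans (lerD gm (lexx _)).
  rewrite -(enormN (fun i => gamma _ i - _ - _)) -(enormN (fun i => - h i - _)).
  apply: le_trans (ler_enormD _ _).
  rewrite le_eqVlt; apply/orP; left; apply/eqP; congr enorm.
  by apply/funext => i; ring.
have Np := enorm_subZ_le h T0 v1; rewrite quad -/S in Np.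
have Nm := enorm_subZ_le (fun i => - h i) T0 v1; rewrite enormN quad in Nm.
have SN : \sum_(i < d) v i * - h i = - S.
  by rewrite -sumrN; apply: eq_bigr => i _; rewrite mulrN.
rewrite SN in Nm.
(* The point ahead on the curve bounds the increment of [f] from below, the one behind from
   above. *)
have Fp := Lip1_le Lf (ocube_cube (Og _ pT)) Ch.
have Fm := Lip1_le Lf Ch (ocube_cube (Og _ mT)).
by apply/andP; split; lra.
Qed.

End CurveDerivative.

(** * Vitali covering and Lebesgue density *)

Section CoveringAndDensity.
Context {R : realType}.
Local Notation mu := (@lebesgue_measure R).

(** By induction on the number of intervals: the first one splits the others into those on its left
    and those on its right. *)
Lemma sum_increments_le (psi lo hi : R -> R) (s : seq R) (a b : R) :
  (forall x y, a <= x -> x <= y -> y <= b -> psi x <= psi y) ->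
  a <= b -> uniq s ->
  (forall i, i \in s -> [/\ a <= lo i, lo i <= hi i & hi i <= b]) ->
  (forall i j, i \in s -> j \in s -> i != j -> hi i <= lo j \/ hi j <= lo i) ->
  \sum_(i <- s) (psi (hi i) - psi (lo i)) <= psi b - psi a.
Proof.
have [n sn] := ubnP (size s); elim: n s a b sn => // n IH [|i s] a b sn mpsi ab us.
  by rewrite big_nil subr_ge0 => _ _; exact: mpsi.
move=> lh dis; have [ai li ib] := lh i (mem_head _ _).
move: us => /= /andP[nis us].
pose p j := hi j <= lo i.
rewrite big_cons (bigID p)/= -big_filter -[X in _ + (_ + X)]big_filter.
have sub (q : pred R) : (size [seq j <- s | q j] < n)%N.
  by rewrite size_filter (leq_ltn_trans (count_size _ _)).
have mem (q : pred R) j : j \in [seq j <- s | q j] -> q j /\ j \in i :: s.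
  by rewrite mem_filter => /andP[qj js]; rewrite in_cons js orbT.
have L : \sum_(j <- [seq j <- s | p j]) (psi (hi j) - psi (lo j)) <=
    psi (lo i) - psi a.
  apply: IH => //; last 2 first.
  - by move=> j /mem[pj /lh[? ? ?]].
  - by move=> j k /mem[_ js] /mem[_ ks]; exact: dis.
  - by move=> x y ax xy yb; apply: mpsi => //; lra.
  - exact: filter_uniq.
have H : \sum_(j <- [seq j <- s | ~~ p j]) (psi (hi j) - psi (lo j)) <=
    psi b - psi (hi i).
  apply: IH => //; last 2 first.
  - move=> j /[dup] /mem[/negP pj js']; rewrite mem_filter => /andP[_ js].
    have [? ? ?] := lh j js'; split => //.
    have ij : i != j by apply: contraNneq nis => ->.
    by case: (dis i j (mem_head _ _) js' ij).
  - by move=> j k /mem[_ js] /mem[_ ks]; exact: dis.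
  - by move=> x y ax xy yb; apply: mpsi => //; lra.
  - exact: filter_uniq.
by lra.
Qed.

(* The points where [psi] has a difference quotient larger than [lam] are covered
   by triples of disjoint balls on whose halves [psi] grows by [lam] times the
   radius. *)
Lemma small_quotient_point (K : set R) (psi : R -> R) (a b lam : R) :
  compact K -> K `<=` `[a, b] -> a <= b -> 0 < lam ->
  (forall x y, a <= x -> x <= y -> y <= b -> psi x <= psi y) ->
  ((6 * (psi b - psi a) / lam)%:E < mu K)%E ->
  exists2 t, K t & forall y, a <= y <= b -> `|psi y - psi t| <= lam * `|y - t|.
Proof.
move=> cK Kab ab lam0 mpsi muK; apply: contrapT => noP.
(* Outside [K] the value of [Y] is arbitrary, but different from [t] to keep all radii positive. *)
have exY t : exists y, 0 < `|y - t| /\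
    (K t -> a <= y <= b /\ lam * `|y - t| < `|psi y - psi t|).
  have [Kt|nKt] := pselect (K t); last first.
    by exists (t + 1); split => //; rewrite addrC addKr normr1.
  apply: contrapT => no; apply: noP; exists t => // y yab.
  rewrite leNgt; apply/negP => lt; apply: no; exists y; split => //.
  rewrite normr_gt0 subr_eq0; apply/eqP => yt.
  by move: lt; rewrite yt !subrr normr0 mulr0 ltxx.
have [Y YP] := choice exY.
pose r (t : R) : R := `|Y t - t|; pose B (t : R) : set R := ball t (r t).
have r0 t : 0 < r t by have [] := YP t.
have [D DK Kcover] : finite_subset_cover K B K.
  move: cK; rewrite compact_cover; apply; first by move=> t _; exact: ball_open.
  by move=> t Kt; exists t => //; exact: ballxx.
have is_ballB i : is_ball (B i) by exact: is_ball_ball.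
have Bset0 i : B i !=set0 by exists i; exact: ballxx.
have [E [uE ED tEB DE]] := @vitali_lemma_finite_cover _ _ B is_ballB Bset0
  (finmap.enum_fset D).
have KE : K `<=` cover [set` E] (scale_ball 3%:R \o B).
  by apply: subset_trans DE => t /Kcover[i Di ti]; exists i.
have EK i : i \in E -> K i by move=> /ED Di; exact: set_mem (DK i Di).
have muKle : (mu K <= (\sum_(i <- E) 6 * r i)%:E)%E.
  apply: (le_trans (@content_subadditive _ _ _ mu K
      (fun i => (3 *` B (nth 0%R E i))%classic) (size E) _ _ _)) => //.
  - by move=> k ?; rewrite scale_ballE//; exact: measurable_ball.
  - by apply: closed_measurable; apply: compact_closed => //; exact: Rhausdorff.
  - apply: (subset_trans KE); rewrite /cover bigcup_seq.
    by rewrite (big_nth 0%R)//= big_mkord.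
  - rewrite (big_nth 0%R) big_mkord -sumEFin; apply: lee_sum => i _.
    rewrite /= scale_ballE// lebesgue_measure_ball ?mulr_ge0 ?(ltW (r0 _))//.
    by rewrite lee_fin mulr2n; lra.
(* Between [t] and [Y t] lies one half of the ball [B t]. *)
pose lo t := Num.min t (Y t); pose hi t := Num.max t (Y t).
have lohi t : hi t - lo t = r t.
  rewrite /hi /lo /r; have [tY|/ltW Yt] := leP t (Y t).
    by rewrite ger0_norm// subr_ge0.
  by rewrite distrC ger0_norm// subr_ge0.
have inB t z : lo t < z -> z < hi t -> B t z.
  rewrite /hi /lo /B /r /ball/=; have [tY|/ltW Yt] := leP t (Y t) => ? ?.
    by rewrite [ltRHS]ger0_norm ?subr_ge0// ltr_norml; apply/andP; split; lra.
  rewrite [ltRHS]distrC [ltRHS]ger0_norm ?subr_ge0// ltr_norml.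
  by apply/andP; split; lra.
have incr t : K t -> [/\ a <= lo t, hi t <= b &
    lam * r t <= psi (hi t) - psi (lo t)].
  move=> Kt; have [_ /(_ Kt)[/andP[aY Yb] lt]] := YP t.
  have := Kab t Kt; rewrite /= in_itv/= => /andP[at_ tb].
  rewrite /lo /hi /r; have [tY|/ltW Yt] := leP t (Y t); split => //.
    move: lt; rewrite [X in _ < X]ger0_norm; first exact: ltW.
    by rewrite subr_ge0; exact: mpsi.
  move: lt; rewrite [X in _ < X]distrC [X in _ < X]ger0_norm; first exact: ltW.
  by rewrite subr_ge0; exact: mpsi.
have S : \sum_(i <- E) (psi (hi i) - psi (lo i)) <= psi b - psi a.
  apply: sum_increments_le => //.
    move=> i /EK/incr[? ? _]; split => //.
    by rewrite -subr_ge0 lohi ltW.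
  move=> i j iE jE ij; apply: contrapT => /not_orP[/negP + /negP].
  rewrite -!ltNge => ji ij'.
  have li : lo i < hi i by rewrite -subr_gt0 lohi.
  have lj : lo j < hi j by rewrite -subr_gt0 lohi.
  (* Two overlapping halves would have a common interior point, against the disjointness of the
     selected balls. *)
  have [z /andP[]] : exists z, Num.max (lo i) (lo j) < z < Num.min (hi i) (hi j).
    exists ((Num.max (lo i) (lo j) + Num.min (hi i) (hi j)) / 2).
    have : Num.max (lo i) (lo j) < Num.min (hi i) (hi j).
      by rewrite gt_max !lt_min li lj ji ij'.
    by move=> ?; apply/andP; split; lra.
  rewrite gt_max lt_min => /andP[? ?] /andP[? ?].
  have zij : (B i `&` B j) !=set0 by exists z; split; exact: inB.
  by move/eqP: ij; apply; exact: tEB zij.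
move: muK; apply/negP; rewrite -leNgt; apply: le_trans muKle _.
rewrite lee_fin ler_pdivlMr// -mulr_sumr -mulrA ler_pM2l//.
apply: le_trans S; rewrite mulr_suml big_seq [leRHS]big_seq.
by apply: ler_sum => i /EK/incr[_ _]; rewrite mulrC.
Qed.

(** Almost every point of [F] is a density point, and leaving out [0] and [1] costs a null set;
    small intervals around the point then stay in [[0, 1]]. Density one half in a ball of length
    [2 rho] gives measure [rho]. *)
Lemma density_point (F : set R) (t1 delta : R) : closed F ->
  every_portion_pos F -> F t1 -> 0 < delta ->
  exists t, [/\ F t, `|t1 - t| < delta, t != 0, t != 1 &
    exists2 d0, 0 < d0 & forall rho, 0 < rho -> rho < d0 ->
      (rho%:E <= mu (F `&` ball t rho))%E].
Proof.
move=> cF pF Ft1 delta0.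
have mF : measurable F by exact: closed_measurable.
have FU : (0 < mu (ball t1 delta `&` F))%E.
  by apply: pF; [exact: ball_open|exists t1; split => //; exact: ballxx].
have [t [[ut Ft] t0 t1' dt]] : exists t, [/\ (ball t1 delta `&` F) t, t != 0, t != 1 &
    (mu (F `&` ball t r) / mu (ball t r))%E @[r --> 0^'+] --> (\1_F t)%:E].
  apply: contrapT => no.
  have N : mu.-negligible (~` [set x | (mu (F `&` ball x r) / mu (ball x r))%E
      @[r --> 0^'+] --> (\1_F x)%:E] `|` ([set 0] `|` [set 1])).
    apply: negligibleU; first exact: lebesgue_density.
    by apply: negligibleU; apply/negligibleP => //; exact: lebesgue_measure_set1.
  have : mu.-negligible (ball t1 delta `&` F).
    apply: negligibleS N => t tUF; apply: contrapT => /not_orP[/contrapT dt].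
    move=> /not_orP[/eqP t0 /eqP t1']; apply: no; exists t; split => //.
  move/negligibleP => /(_ (measurableI _ _ (measurable_ball _ _) mF)) M0.
  by move: FU; rewrite M0 ltxx.
exists t; split => //.
have : \forall r \near 0^'+, ((2^-1)%:E < mu (F `&` ball t r) / mu (ball t r))%E.
  apply: (dt [set y | ((2^-1)%:E < y)%E]).
  apply: open_nbhs_nbhs; split; first exact: open_ereal_gt_ereal.
  by rewrite /= indicE mem_set// lte_fin invf_lt1// ltr1n.
move=> /nbhs_ballP[d0 /= d00 H]; exists d0 => // rho rho0 rhod.
have := H rho; rewrite /ball/= sub0r normrN gtr0_norm// => /(_ rhod rho0).
rewrite lebesgue_measure_ball ?(ltW rho0)// inver mulrn_eq0/= gt_eqF//.
move/ltW; rewrite lee_pdivlMr ?mulrn_wgt0//.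
by apply: le_trans; rewrite -EFinM lee_fin -mulr_natr; lra.
Qed.

End CoveringAndDensity.

(** * Admissible intervals, and straightening that keeps the slopes at larger scales *)

Section Extension.
Context {R : realType} {d : nat}.
Local Notation mu := (@lebesgue_measure R).
Variables (gamma : R -> 'I_d -> R) (F : set R) (G : nat -> set R).
Implicit Types (f g : ('I_d -> R) -> R) (n : nat) (a b t : R).

Definition tolerance n : R := n.+1%:R^-1.

Lemma tolerance_gt0 n : 0 < tolerance n.
Proof. by rewrite invr_gt0. Qed.

Lemma tolerance_le1 n : tolerance n <= 1.
Proof. by rewrite invf_le1// ler1n. Qed.

Definition middle_third a b : set R := `[a + (b - a) / 3, b - (b - a) / 3].

(** The conditions on the interval that do not involve [f]. The constants fit [steep]: the
    exceptional set of [small_quotient_point] has measure at most [6/100] of the length, less than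
    the [1/10] available in the middle third. *)
Definition admissible n a b :=
  [/\ [/\ 0 <= a, a < b & b <= 1],
      (((b - a) / 10)%:E <= mu (F `&` middle_third a b))%E,
      forall t, F t -> a <= t <= b -> G n t &
      exists2 tau, 0 < tau & forall t, F t -> a <= t <= b ->
        almost_straight gamma t tau (tolerance n / 100)].

Definition steep n a b f :=
  defect gamma f b - defect gamma f a < tolerance n / 100 * (b - a).

(** With [[alpha, beta]] the parent of [[a, b]], this controls the slopes seen from the central half
    of [[a, b]] at all distances from a quarter of its length up to the size of the parent. *)
Definition slopes_near1 (alpha beta a b kappa : R) f := forall x y,
  a + (b - a) / 4 <= x <= b - (b - a) / 4 -> 0 <= y <= 1 ->
  alpha <= y <= beta -> (b - a) / 4 <= `|y - x| ->
  `|defect gamma f y - defect gamma f x| <= kappa * `|y - x|.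

Lemma exists_lt_all (l : seq R) : all (> 0) l ->
  exists2 rho, 0 < rho & all (> rho) l.
Proof.
elim: l => [|x l IH] /=; first by exists 1.
move=> /andP[x0 /IH[rho rho0 rhol]].
have m0 : 0 < Num.min x rho / 2 by rewrite divr_gt0// lt_min x0.
exists (Num.min x rho / 2) => //; apply/andP; split.
  by have : Num.min x rho <= x; [rewrite ge_min lexx|lra].
apply: sub_all rhol => y; apply: lt_trans.
by have : Num.min x rho <= rho; [rewrite ge_min lexx orbT|lra].
Qed.

Lemma almost_straightW t tau (e e' : R) : e <= e' ->
  almost_straight gamma t tau e -> almost_straight gamma t tau e'.
Proof.
move=> ee' H x y x0 xt ty y1 tx yt; apply: le_trans (H x y x0 xt ty y1 tx yt).
by apply: ler_wpM2r; lra.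
Qed.

(** Three ranges of distance: up to [rho] the slope is new, between [rho] and [tau] the bound
    [kappa] survives, and from [tau] on a change of at most [2 rho <= lambda tau] costs [lambda] in
    the quotient. *)
Lemma straighten_keep_slopes f t (tau rho e kappa lambda : R) (A : set R) :
  unit_speed_curve gamma -> Lip1 d f -> 0 <= t <= 1 ->
  0 < rho -> rho < tau -> 0 <= e <= kappa -> 0 < lambda ->
  2 * rho <= lambda * tau -> almost_straight gamma t tau e ->
  (forall y, 0 <= y <= 1 -> A y -> rho <= `|y - t| ->
     `|defect gamma f y - defect gamma f t| <= kappa * `|y - t|) ->
  exists g, [/\ Lip1 d g,
    forall x, cube d x -> `|f x - g x| <= 2 * rho,
    forall y, 0 <= y <= 1 -> `|y - t| <= rho ->
      `|defect gamma g y - defect gamma g t| <= e * `|y - t| &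
    forall y, 0 <= y <= 1 -> A y ->
      `|defect gamma g y - defect gamma g t| <= (kappa + lambda) * `|y - t|].
Proof.
move=> Ug Lf t01 rho0 rhot /andP[e0 ek] lam0 rl St Af.
have [g [Lg fg egt near mid]] := straighten_along_curve Ug Lf t01 rho0 rhot e0 St.
exists g; split => // y y01 Ay; rewrite mulrDl.
have ly : 0 <= lambda * `|y - t| by rewrite mulr_ge0// ltW.
have [yr|ry] := leP `|y - t| rho.
  apply: le_trans (near y y01 yr) _.
  have : e * `|y - t| <= kappa * `|y - t| by rewrite ler_wpM2r.
  by lra.
have fy := Af y y01 Ay (ltW ry).
have [yt|ty] := ltP `|y - t| tau.
  by apply: le_trans (mid kappa y ek y01 yt fy) _; lra.
have := fg _ (ocube_cube (Ug.1 y y01)).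
have : lambda * tau <= lambda * `|y - t| by rewrite ler_pM2l.
move=> lt fgy; rewrite /defect egt.
have -> : y - g (gamma y) - (t - f (gamma t)) =
  (defect gamma f y - defect gamma f t) + (f (gamma y) - g (gamma y)).
  by rewrite /defect; ring.
by apply: le_trans (ler_normD _ _) _; lra.
Qed.

End Extension.
Arguments tolerance : clear implicits.

(** * A single extension: a shorter interval with slope closer to one *)

Record curve_setting (R : realType) (d : nat) (gamma : R -> 'I_d -> R)
    (F E : set R) (G : nat -> set R) : Prop := CurveSetting {
  setting_curve : unit_speed_curve gamma;
  setting_closed : closed F;
  setting_sub01 : F `<=` `[0, 1];
  setting_portion : every_portion_pos F;
  setting_open : forall n, open_in (@R_ball R) F (G n);
  setting_dense : forall n, dense_in (@R_ball R) F (G n);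
  setting_residual : forall t, F t -> (forall n, G n t) -> E t;
  setting_deriv : forall t, E t -> exists2 v, curve_deriv gamma t v & enorm v = 1
}.

(** Three moves, each shorter than [zeta / 3]: into [G n], then to a portion of [F] where [gamma] is
    uniformly straight, then to a density point. *)
Lemma straight_density_point (R : realType) (d : nat) (gamma : R -> 'I_d -> R)
    (F E : set R) (G : nat -> set R) (n : nat) (t zeta : R) :
  curve_setting gamma F E G -> F t -> 0 < zeta ->
  exists s omega tau, [/\ [/\ F s, `|t - s| < zeta & 0 < s < 1],
    [/\ 0 < omega, 0 < tau & forall u, F u -> `|s - u| < omega ->
      G n u /\ almost_straight gamma u tau (tolerance R n / 200)] &
    exists2 d0, 0 < d0 & forall rho, 0 < rho -> rho < d0 ->
      (rho%:E <= lebesgue_measure (F `&` ball s rho))%E].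
Proof.
move=> [Ug cF F01 pF oG dG GE Eg] Ft zeta0; have z3 : 0 < zeta / 3 by rewrite divr_gt0.
have [ta [Fta Gta tta]] := dG n t Ft _ z3.
have [q q0 qG] := oG n ta Fta Gta.
have m0 : 0 < Num.min (q / 3) (zeta / 3) by rewrite lt_min z3 divr_gt0.
have resE : residual_in (@R_ball R) F E by exists G; split.
have e1 : 0 < tolerance R n / 200 <= 1.
  by have := @tolerance_gt0 R n; have := @tolerance_le1 R n => *; apply/andP; split; lra.
have [tb [delta [tau [Ftb tab delta0 tau0 St]]]] :=
  almost_straight_portion Ug cF F01 resE Eg Fta m0 e1.
(* Points within [omega] of [s] are within [delta] of [tb] and within [q] of [ta]. *)
pose omega := Num.min (delta / 2) (Num.min (q / 3) (zeta / 3)).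
have omega0 : 0 < omega by rewrite !lt_min z3 !divr_gt0.
have [s [Fs tbs s0 s1 dens]] := density_point cF pF Ftb omega0.
move: tbs tab tta; rewrite /R_ball !lt_min => /and3P[bs1 bs2 bs3] /andP[ab1 ab2] tta.
have s01 := F01 s Fs; rewrite /= in_itv/= in s01; have /andP[s0' s1'] := s01.
exists s, omega, tau; split => //.
- split => //; last by rewrite !lt_neqAle eq_sym s0 s0' s1 s1'.
  by have := ler_distD ta t s; have := ler_distD tb ta s; lra.
- split => // u Fu; rewrite !lt_min => /and3P[su1 su2 su3]; split.
    by apply: qG => //; rewrite /R_ball; have := ler_distD tb ta u; have := ler_distD s tb u; lra.
  by apply: St => //; have := ler_distD s tb u; lra.
Qed.

Lemma steep_interval (R : realType) (d : nat) (gamma : R -> 'I_d -> R)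
    (F : set R) (G : nat -> set R) (n : nat) (g : ('I_d -> R) -> R)
    (s alpha beta lambda rho tau : R) :
  closed F ->
  0 < rho -> rho < s -> rho < 1 - s -> alpha <= s - rho -> s + rho <= beta ->
  0 < lambda -> 0 < tau ->
  (forall u, F u -> `|u - s| <= rho ->
     G n u /\ almost_straight gamma u tau (tolerance R n / 200)) ->
  ((rho / 5)%:E <= lebesgue_measure (F `&` ball s (rho / 5)))%E ->
  (forall y, 0 <= y <= 1 -> `|y - s| <= rho ->
     `|defect gamma g y - defect gamma g s| <= tolerance R n / 200 * `|y - s|) ->
  (forall y, 0 <= y <= 1 -> alpha <= y <= beta ->
     `|defect gamma g y - defect gamma g s| <= 5 * lambda * `|y - s|) ->
  exists a b : rat, [/\ s - rho < ratr a /\ ratr b < s + rho,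
    admissible gamma F G n (ratr a) (ratr b), steep gamma n (ratr a) (ratr b) g &
    slopes_near1 gamma alpha beta (ratr a) (ratr b) (45 * lambda) g].
Proof.
move=> cF rho0 rs r1s alphas sbeta lam0 tau0 near_s dens near all_.
(* Endpoints within [rho / 10] of [s - rho] and [s + rho]: then [b - a < 2 rho], and the middle
   third contains the ball of radius [rho / 5]. *)
have [a /andP[]] : exists a : rat, s - rho < ratr a < s - rho * (9 / 10).
  have : s - rho < s - rho * (9 / 10) by clear -rho0; lra.
  by move=> /rat_in_itvoo[a]; rewrite in_itv/= => ?; exists a.
have [b /andP[]] : exists b : rat, s + rho * (9 / 10) < ratr b < s + rho.
  have : s + rho * (9 / 10) < s + rho by clear -rho0; lra.
  by move=> /rat_in_itvoo[b]; rewrite in_itv/= => ?; exists b.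
move=> b1 b2 a1 a2; exists a, b.
move: (ratr a) (ratr b) a1 a2 b1 b2 => {}a {}b a1 a2 b1 b2.
have dab y : a <= y <= b -> `|y - s| <= rho.
  by clear -a1 b2 => /andP[? ?]; rewrite ler_norml; apply/andP; split; lra.
have y01 y : a <= y <= b -> 0 <= y <= 1.
  by clear -a1 b2 rs r1s => /andP[? ?]; apply/andP; split; lra.
have ab : a < b by clear -rho0 a2 b1; lra.
split => //.
- split.
  + by clear -rs r1s a1 b2 ab; split; lra.
  + apply: le_trans (le_trans dens _).
      by clear -a1 b2; rewrite lee_fin; lra.
    have mF : measurable F by exact: closed_measurable.
    apply: le_measure; [apply: mem_set|apply: mem_set|].
    * by apply: measurableI => //; exact: measurable_ball.
    * by apply: measurableI => //; exact: measurable_itv.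
    * move=> u [Fu]; rewrite /ball/= ltr_norml => /andP[u1 u2]; split => //.
      clear -u1 u2 a1 a2 b1 b2.
      by rewrite /middle_third/= in_itv/=; apply/andP; split; lra.
  + by move=> u Fu /dab ur; have [] := near_s u Fu ur.
  + exists tau => // u Fu /dab ur.
    apply: (@almost_straightW _ _ _ _ _ (tolerance R n / 200)).
      by have := @tolerance_gt0 R n; clear; lra.
    by have [] := near_s u Fu ur.
(* Half the constant of [steep] leaves the inequality strict. *)
- have aI : a <= a <= b by rewrite lexx ltW.
  have bI : a <= b <= b by rewrite lexx ltW.
  have := near b (y01 b bI) (dab b bI); have := near a (y01 a aI) (dab a aI).
  have tol0 := @tolerance_gt0 R n.
  have : 0 < tolerance R n * (b - a) by rewrite mulr_gt0// subr_gt0.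
  rewrite (distrC a s) (@ger0_norm _ (s - a)) ?(@ger0_norm _ (b - s)).
  + by clear; rewrite !ler_norml /steep => ? /andP[? _] /andP[_ ?]; lra.
  + by clear -b1 rho0; lra.
  + by clear -a2 rho0; lra.
(* Since [|x - s| <= b - a <= 4 |y - x|], the sum [|y - s| + |x - s|] is at most [9 |y - x|], whence
   [45 = 5 * 9]. *)
- move=> x y /andP[xa xb] yI yab yx.
  have xI : a <= x <= b by clear -xa xb ab; apply/andP; split; lra.
  have xab : alpha <= x <= beta.
    by clear -xI a1 b2 alphas sbeta; case/andP: xI => *; apply/andP; split; lra.
  apply: le_trans (ler_distD (defect gamma g s) _ _) _.
  rewrite [X in _ + X]distrC.
  apply: le_trans (lerD (all_ y yI yab) (all_ x (y01 x xI) xab)) _.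
  have xs : `|x - s| <= b - a.
    clear -xI a1 a2 b1 b2 rho0; case/andP: xI => *.
    by rewrite ler_norml; apply/andP; split; lra.
  have ys := ler_distD x y s.
  have : lambda * (5 * (`|y - s| + `|x - s|)) <= lambda * (45 * `|y - x|).
    by rewrite ler_pM2l//; clear -ys xs yx; lra.
  by clear; lra.
Qed.

(** The function is straightened twice around a point [s] near [t]. The first time, with tolerance
    [e], covers the small scales at which the slopes at [t] do not carry over to [s]; the second, at
    a scale depending on [s], reaches [tolerance R n / 200]. *)
Lemma extend_steep (R : realType) (d : nat) (gamma : R -> 'I_d -> R)
    (F E : set R) (G : nat -> set R) (n : nat) (f : ('I_d -> R) -> R)
    (t alpha beta lambda e xi r : R) :
  curve_setting gamma F E G ->
  Lip1 d f -> F t -> tolerance R n <= lambda -> 0 <= e <= lambda ->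
  0 < xi -> 0 < r -> alpha <= t - xi -> t + xi <= beta ->
  (forall y, 0 <= y <= 1 -> alpha <= y <= beta ->
     `|defect gamma f y - defect gamma f t| <= lambda * `|y - t|) ->
  (exists2 delta, 0 < delta & exists2 tau, 0 < tau &
     forall s, F s -> `|t - s| < delta -> almost_straight gamma s tau e) ->
  exists g (a b : rat), [/\ Lip1 d g,
    forall x, cube d x -> `|f x - g x| <= r,
    t - xi < ratr a /\ ratr b < t + xi,
    admissible gamma F G n (ratr a) (ratr b) /\ steep gamma n (ratr a) (ratr b) g &
    slopes_near1 gamma alpha beta (ratr a) (ratr b) (45 * lambda) g].
Proof.
move=> S Lf Ft tol /andP[e0 el] xi0 r0 axi xib good [delta delta0 [tau tau0 St]].
have Ug := setting_curve S; have tol0 := @tolerance_gt0 R n.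
have lam0 : 0 < lambda by exact: lt_le_trans tol.
(* Fixed before [s], so that [s] can then be taken within [rho] of [t]. *)
have [|rho rho0 /and4P[rho1 rt rho3 _]] :=
  @exists_lt_all R [:: r / 4; tau; lambda * tau / 2].
  by rewrite /= tau0 !divr_gt0// mulr_gt0.
have [|zeta zeta0 /and4P[zxi zdel zrho _]] := @exists_lt_all R [:: xi; delta; rho].
  by rewrite /= xi0 delta0 rho0.
have [s [omega [tau' [[Fs ts s01] [omega0 tau'0 near_s] [d0 d00 dens]]]]] :=
  straight_density_point n S Ft zeta0.
have /andP[s0 s1] := s01; have s01' : 0 <= s <= 1 by rewrite !ltW.
have tsxi := lt_trans ts zxi.
have sab : alpha <= s <= beta.
  clear -tsxi axi xib; move: tsxi.
  by rewrite ltr_norml => /andP[? ?]; apply/andP; split; lra.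
pose A := [set y : R | alpha <= y <= beta].
(* As [|t - s| < rho <= |y - s|], the sum [|y - t| + |s - t|] is at most [3 |y - s|]. *)
have good1 y : 0 <= y <= 1 -> A y -> rho <= `|y - s| ->
    `|defect gamma f y - defect gamma f s| <= (3 * lambda) * `|y - s|.
  move=> y01 Ay ry.
  have gy := good y y01 Ay; have gs := good s s01' sab.
  apply: le_trans (ler_distD (defect gamma f t) _ _) _.
  rewrite [X in _ + X]distrC; apply: le_trans (lerD gy gs) _.
  have yst := ler_distD s y t; rewrite (distrC t s) in ts.
  have : lambda * (`|y - t| + `|s - t|) <= lambda * (3 * `|y - s|).
    by rewrite ler_pM2l//; clear -yst ts zrho ry; lra.
  by clear; lra.
have e3 : 0 <= e <= 3 * lambda by clear -e0 el lam0; apply/andP; split; lra.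
have rl : 2 * rho <= lambda * tau by clear -rho3; lra.
have [g1 [L1 fg1 _ all1]] := straighten_keep_slopes Ug Lf s01' rho0 rt e3
  lam0 rl (St s Fs (lt_trans ts zdel)) good1.
have [|rho' rho'0 /and5P[q1 q2 q3 q4 /and5P[q5 q6 q7 q8 _]]] :=
  @exists_lt_all R [:: r / 4; tau'; lambda * tau' / 2; omega; d0;
                     xi - `|t - s|; s; 1 - s].
  by rewrite /= omega0 tau'0 d00 s0 !subr_gt0 s1 tsxi !divr_gt0// mulr_gt0.
have e' : 0 <= tolerance R n / 200 <= 3 * lambda + lambda.
  by clear -tol tol0; apply/andP; split; lra.
have rl' : 2 * rho' <= lambda * tau' by clear -q3; lra.
have Ss := near_s s Fs; rewrite subrr normr0 in Ss.
(* The first straightening gave [4 lambda] at all distances in [A]; this one adds another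
   [lambda]. *)
have [g [Lg fg near all2]] := straighten_keep_slopes Ug L1 s01' rho'0 q2 e'
  lam0 rl' (Ss omega0).2 (fun y y01 Ay _ => all1 y y01 Ay).
have ts1 : t - s <= `|t - s| := ler_norm _.
have ts2 : s - t <= `|t - s| by rewrite distrC ler_norm.
have [|||||a [b [[sa bs] adm stp slp]]] := @steep_interval R d gamma F G n g s
    alpha beta lambda rho' tau' (setting_closed S) rho'0 q7 q8 _ _ lam0 tau'0 _ _ near _.
- by clear -q6 ts1 axi; lra.
- by clear -q6 ts2 xib; lra.
- by move=> u Fu us; apply: near_s => //; rewrite distrC; exact: le_lt_trans q4.
- by apply: dens; clear -rho'0 q5; lra.
- move=> y y01 yab; have := all2 y y01 yab.
  by rewrite (_ : 3 * lambda + lambda + lambda = 5 * lambda)//; ring.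
exists g, a, b; split => //.
- move=> x Cx; have := fg x Cx; have := fg1 x Cx.
  by have := ler_distD (g1 x) (f x) (g x); clear -rho1 q1; lra.
- by clear -q6 ts1 ts2 sa bs; split; lra.
Qed.

(** * Countably many dense open conditions *)

Lemma residual_in_countable (R : realType) (T : Type) (B : T -> R -> T -> Prop)
    (X S : set T) (C : countType) (W : C -> set T) :
  (forall x r, X x -> 0 < r -> B x r x) ->
  (forall c, open_in B X (W c)) -> (forall c, dense_in B X (W c)) ->
  (forall x, X x -> (forall c, W c x) -> S x) -> residual_in B X S.
Proof.
move=> Bxx oW dW WS.
exists (fun k => if unpickle k is Some c then W c else setT); split.
- by move=> k; case: (unpickle k) => [c|]; [exact: oW|move=> f _ _; exists 1].
- move=> k; case: (unpickle k) => [c|]; first exact: dW.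
  by move=> x Xx r r0; exists x; split => //; exact: Bxx.
by move=> x Xx Ux; apply: WS => // c; have := Ux (pickle c); rewrite pickleK.
Qed.

Definition steep_at (R : realType) (d : nat) (gamma : R -> 'I_d -> R) (F : set R)
    (G : nat -> set R) (n : nat) (a b : rat) (f : ('I_d -> R) -> R) :=
  admissible gamma F G n (ratr a) (ratr b) /\ steep gamma n (ratr a) (ratr b) f.

(** Slopes up to the scale of the parent are measured by [tolerance R n], while steepness already
    has index [n + 1]. The construction yields [45]; asking for some [kappa] strictly below [46]
    makes the condition open. *)
Definition refines (R : realType) (d : nat) (gamma : R -> 'I_d -> R) (F : set R)
    (G : nat -> set R) (n : nat) (a b a' b' : rat) (f : ('I_d -> R) -> R) :=
  let A : R := ratr a in let B : R := ratr b in
  [/\ A + (B - A) / 4 < ratr a', ratr b' < B - (B - A) / 4,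
      steep_at gamma F G n.+1 a' b' f &
      exists2 kappa, kappa < 46 * tolerance R n &
        slopes_near1 gamma A B (ratr a') (ratr b') kappa f].

Lemma defect_close (R : realType) (d : nat) (gamma : R -> 'I_d -> R)
    (f g : ('I_d -> R) -> R) (r y : R) : unit_speed_curve gamma ->
  (forall x, cube d x -> `|f x - g x| <= r) -> 0 <= y <= 1 ->
  `|defect gamma f y - defect gamma g y| <= r.
Proof.
move=> [Og _] fg y01; have := fg _ (ocube_cube (Og y y01)).
rewrite (_ : defect gamma f y - defect gamma g y = - (f (gamma y) - g (gamma y))).
  by rewrite normrN.
by rewrite /defect; ring.
Qed.

Lemma steep_at_open (R : realType) (d : nat) (gamma : R -> 'I_d -> R)
    (F : set R) (G : nat -> set R) (n : nat) (a b : rat) :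
  unit_speed_curve gamma ->
  open_in (@sup_ball R d) (Lip1 d) (steep_at gamma F G n a b).
Proof.
move=> Ug f Lf [adm]; rewrite /steep.
have [[a0 ab b1] _ _ _] := adm; rewrite /steep_at.
move: (ratr a) (ratr b) => {}a {}b in adm a0 ab b1 * => st.
exists ((tolerance R n / 100 * (b - a) - (defect gamma f b - defect gamma f a)) / 2).
  by rewrite divr_gt0// subr_gt0.
move=> g Lg [r [rr fg]]; split => //; rewrite /steep.
have a01 : 0 <= a <= 1 by clear -a0 ab b1; apply/andP; split; lra.
have b01 : 0 <= b <= 1 by clear -a0 ab b1; apply/andP; split; lra.
have := defect_close Ug fg a01; have := defect_close Ug fg b01.
by clear -rr; rewrite !ler_norml => /andP[? ?] /andP[? ?]; lra.
Qed.

Lemma refines_open (R : realType) (d : nat) (gamma : R -> 'I_d -> R)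
    (F : set R) (G : nat -> set R) (n : nat) (a b a' b' : rat) :
  unit_speed_curve gamma ->
  open_in (@sup_ball R d) (Lip1 d) (refines gamma F G n a b a' b').
Proof.
move=> Ug f Lf [aa' bb' st [kappa kl sl]].
have [r1 r10 H1] := steep_at_open Ug Lf st.
have [[[a0 ab b1] _ _ _] _] := st.
pose L : R := ratr b' - ratr a'.
have L0 : 0 < L by rewrite subr_gt0.
pose q := (46 * tolerance R n - kappa) / 2.
have q0 : 0 < q by rewrite divr_gt0// subr_gt0.
(* Two defects, each moved by less than [q L / 8], change the difference by at most [q |y - x|],
   because [|y - x| >= L / 4]. *)
exists (Num.min r1 (q * L / 8)); first by rewrite lt_min r10 divr_gt0// mulr_gt0.
move=> g Lg [r [+ fg]]; rewrite lt_min => /andP[rr1 rq].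
split => //; first by apply: H1 => //; exists r.
exists (kappa + q); first by rewrite /q; clear -kl; lra.
move=> x y xI y01 yab yx.
have x01 : 0 <= x <= 1.
  by clear -xI a0 ab b1; case/andP: xI => *; apply/andP; split; lra.
have Dx := defect_close Ug fg x01; have Dy := defect_close Ug fg y01.
have Df := sl x y xI y01 yab yx.
have : q * (L / 4) <= q * `|y - x| by rewrite ler_pM2l.
have := ler_distD (defect gamma f y) (defect gamma g y) (defect gamma g x).
have := ler_distD (defect gamma f x) (defect gamma f y) (defect gamma g x).
rewrite (distrC (defect gamma g y) (defect gamma f y)).
by clear -rq Dx Dy Df; lra.
Qed.

Lemma tolerance_decr (R : realType) (m n : nat) : (m <= n)%N ->
  tolerance R n <= tolerance R m.
Proof. by move=> mn; rewrite lef_pV2 ?posrE// ler_nat. Qed.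

(** [small_quotient_point] in the middle third supplies the point at which [extend_steep] applies,
    with [lambda] the tolerance of the parent and [e] its straightness constant. *)
Lemma refines_dense (R : realType) (d : nat) (gamma : R -> 'I_d -> R)
    (F E : set R) (G : nat -> set R) (n : nat) (a b : rat)
    (f : ('I_d -> R) -> R) (r : R) :
  curve_setting gamma F E G -> Lip1 d f -> steep_at gamma F G n a b f -> 0 < r ->
  exists g, [/\ Lip1 d g, exists a' b', refines gamma F G n a b a' b' g &
    sup_ball d f r g].
Proof.
move=> S Lf [[[a0 ab b1] muF _ [tau tau0 St]] st] r0.
rewrite /refines /=; move: (ratr a) (ratr b) => {}a {}b in a0 ab b1 muF tau0 St st *.
have Ug := setting_curve S; have tol0 := @tolerance_gt0 R n.
have cK : compact (F `&` middle_third a b).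
  rewrite setIC; apply: compact_closedI; first exact: segment_compact.
  exact: setting_closed S.
have [|||t [Ft]] := @small_quotient_point R _ (defect gamma f) a b (tolerance R n)
    cK _ (ltW ab) tol0.
- move=> u [_]; rewrite /middle_third /= !in_itv/= => /andP[u1 u2].
  by clear -ab u1 u2; apply/andP; split; lra.
- move=> x y ax xy yb; rewrite -subr_ge0.
  by have /andP[] := defect_mono Ug Lf (le_trans a0 ax) xy (le_trans yb b1).
- apply: lt_le_trans muF; rewrite lte_fin ltr_pdivrMr//.
  have : 0 < tolerance R n * (b - a) by rewrite mulr_gt0// subr_gt0.
  by move: st; rewrite /steep; clear; lra.
rewrite /middle_third /= in_itv/= => /andP[t1 t2] good.
(* As [1/3 - 1/12 = 1/4], the new interval stays in the central half. *)
have xi0 : 0 < (b - a) / 12 by rewrite divr_gt0// subr_gt0.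
have e1 : 0 <= tolerance R n / 100 <= tolerance R n.
  by clear -tol0; apply/andP; split; lra.
have at_ : a <= t - (b - a) / 12 by clear -ab t1; lra.
have tb : t + (b - a) / 12 <= b by clear -ab t2; lra.
have r20 : 0 < r / 2 by rewrite divr_gt0.
have [||g [a' [b' [Lg fg [ta tb'] sta sl]]]] := extend_steep (n := n.+1) S Lf Ft
    (tolerance_decr R (leqnSn n)) e1 xi0 r20 at_ tb.
- by move=> y _; exact: good.
- exists ((b - a) / 12) => //; exists tau => // s Fs; rewrite ltr_norml => /andP[s1 s2].
  by apply: St => //; clear -at_ tb s1 s2; apply/andP; split; lra.
exists g; split => //.
- exists a', b'; split => //.
  + by clear -t1 ta; lra.
  + by clear -t2 tb'; lra.
  + by exists (45 * tolerance R n) => //; clear -tol0; lra.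
- by exists (r / 2); split => //; clear -r0; lra.
Qed.

(** [extend_steep] with trivial data: the defect is [2]-Lipschitz, any curve is almost straight with
    constant [2] because [1 - 2 < 0], and [[-1, 2]] leaves a margin of one around [[0, 1]]. *)
Lemma steep_at0_dense (R : realType) (d : nat) (gamma : R -> 'I_d -> R)
    (F E : set R) (G : nat -> set R) (f : ('I_d -> R) -> R) (r : R) :
  curve_setting gamma F E G -> F !=set0 -> Lip1 d f -> 0 < r ->
  exists g, [/\ Lip1 d g, exists a b, steep_at gamma F G 0 a b g & sup_ball d f r g].
Proof.
move=> S [t Ft] Lf r0; have Ug := setting_curve S.
have t01 : 0 <= t <= 1 by have := setting_sub01 S Ft; rewrite /= in_itv.
have /andP[t0 t1] := t01.
have tol : tolerance R 0 <= 2 by rewrite /tolerance invr1 ler1n.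
have r20 : 0 < r / 2 by rewrite divr_gt0.
have e2 : 0 <= (2 : R) <= 2 by rewrite lexx ler0n.
have at_ : -1 <= t - 1 by clear -t0; lra.
have tb : t + 1 <= 2 by clear -t1; lra.
have [||g [a' [b' [Lg fg _ sta _]]]] := extend_steep (n := 0) S Lf Ft
    tol e2 ltr01 r20 at_ tb.
- by move=> y y01 _; exact: defect_dist_le.
- exists 1 => //; exists 1 => // s Fs _ x y x0 xs sy y1 _ _.
  by have := edist_ge0 (gamma y) (gamma x); clear -xs sy; lra.
exists g; split => //; first by exists a', b'.
by exists (r / 2); split => //; clear -r0; lra.
Qed.

(* Every [y] close to [t] lies at a distance comparable to the length of some
   interval of the sequence, at which scale the slope is controlled. *)
Lemma nested_slopes_fun_deriv (R : realType) (d : nat) (gamma : R -> 'I_d -> R)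
    (F E : set R) (G : nat -> set R) (f : ('I_d -> R) -> R) (a b : nat -> R) :
  curve_setting gamma F E G -> Lip1 d f ->
  (forall n, admissible gamma F G n (a n) (b n)) ->
  (forall n, [/\ a n + (b n - a n) / 4 < a n.+1, b n.+1 < b n - (b n - a n) / 4 &
    exists2 kappa, kappa < 46 * tolerance R n &
      slopes_near1 gamma (a n) (b n) (a n.+1) (b n.+1) kappa f]) ->
  exists2 t, E t & exists2 g, fun_deriv f (gamma t) g & enorm g = 1.
Proof.
move=> S Lf adm ref.
pose L n := b n - a n.
have ab n : [/\ 0 <= a n, a n < b n & b n <= 1] by have [] := adm n.
have L0 n : 0 < L n by have [_ ? _] := ab n; rewrite subr_gt0.
have Lhalf n : L n.+1 <= L n / 2.
  by have [? ? _] := ref n; rewrite /L; lra.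
have [||||t Ft tI] := nested_intervals (a := a) (b := b) (setting_closed S).
- by move=> n; have [? _ _] := ref n; have := L0 n; rewrite /L; lra.
- by move=> n; have [_ ? _] := ref n; have := L0 n; rewrite /L; lra.
- move=> n; have [_ muF _ _] := adm n; apply: contrapT => no.
  move: muF; rewrite (_ : F `&` middle_third (a n) (b n) = set0).
    rewrite measure0 lee_fin; have := L0 n; rewrite /L; lra.
  apply/seteqP; split => // u [Fu]; rewrite /middle_third/= in_itv/= => /andP[u1 u2].
  apply: no; exists u => //; have := L0 n; rewrite /L.
  by move=> ?; apply/andP; split; lra.
- by move=> e e0; exact: (halving_small (l := L)).
(* [t] lies in the next interval, hence strictly inside the central half of this one; in particular
   it is neither [0] nor [1]. *)
have tmid n : a n + L n / 4 < t < b n - L n / 4.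
  have [? ? _] := ref n; have /andP[? ?] := tI n.+1.
  by rewrite /L; apply/andP; split; lra.
have Et : E t.
  apply: (setting_residual S) => // n; have [_ _ Gn _] := adm n.
  exact: Gn.
have [v Dv v1] := setting_deriv S Et.
exists t => //; exists v => //; apply: fun_deriv_of_curve => //.
- exact: setting_curve S.
- have /andP[? ?] := tmid 0%N; have [? _ ?] := ab 0%N; have := L0 0%N.
  by move=> ?; apply/andP; split; lra.
move=> e e0; pose n := Num.bound (46 / e).
have nP : 46 / e < n%:R by apply: archi_boundP; rewrite divr_ge0// ltW.
have ntol : 46 * tolerance R n <= e.
  rewrite /tolerance ler_pdivrMr// mulrC -ler_pdivrMr//.
  by apply: le_trans (ltW nP) _; rewrite ler_nat.
exists (L n / 4); first by rewrite divr_gt0.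
move=> y y01 yt; have [->|yNt] := eqVneq y t.
  by rewrite !subrr normr0 mulr0.
have yt0 : 0 < `|y - t| by rewrite normr_gt0 subr_eq0.
have exk : exists k, L k / 4 <= `|y - t|.
  have [|k] := halving_small (l := fun k => L k / 4) _ yt0.
    by move=> k; have := Lhalf k; lra.
  by move=> /ltW; exists k.
have Ldec i j : (i <= j)%N -> L j <= L i.
  elim: j => [|j IH]; first by rewrite leqn0 => /eqP ->.
  rewrite leq_eqVlt => /orP[/eqP -> //|]; rewrite ltnS => /IH.
  by have := Lhalf j; have := L0 j; lra.
(* The first interval of length at most [4 |y - t|] has an index [m + 1 > n]; by minimality [y] lies
   in interval [m], whose refinement controls the slope at distance [|y - t|]. *)
case: (ex_minnP exk) => -[|m] Lm minm.
  by have := Ldec 0%N n (leq0n n); lra.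
have Lmy : `|y - t| < L m / 4.
  by rewrite ltNge; apply/negP => /minm; rewrite ltnn.
have nm : (n <= m)%N.
  by rewrite leqNgt; apply/negP => mn; have := Ldec _ _ mn; lra.
have [_ _ [kappa kl sl]] := ref m.
have tm := tmid m.+1; have tm' := tmid m.
apply: le_trans (sl t y _ y01 _ _) _ => //.
- by have /andP[? ?] := tm; rewrite !ltW.
- have /andP[tm1 tm2] := tm'; move: Lmy; rewrite ltr_norml => /andP[L1 L2].
  by have := L0 m => ?; apply/andP; split; rewrite /L in tm1 tm2 L1 L2 *; lra.
- rewrite ler_wpM2r//; have := @tolerance_decr R _ _ nm; lra.
Qed.

Unset Implicit Arguments.

Theorem theorem2p8 (R : realType) (d : nat) (F E : set R)
  (gamma : R -> 'I_d -> R) :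
  closed F -> F !=set0 -> F `<=` `[0, 1] -> every_portion_pos F ->
  E `<=` F -> residual_in (@R_ball R) F E ->
  lipschitz_curve gamma ->
  (forall t, 0 <= t <= 1 -> ocube d (gamma t)) ->
  (forall s t, 0 <= s <= 1 -> 0 <= t <= 1 ->
     enorm (fun i => gamma s i - gamma t i) <= `|s - t|) ->
  (forall t, E t -> exists2 v, curve_deriv gamma t v & enorm v = 1) ->
  residual_in (@sup_ball R d) (Lip1 d)
    [set f | exists2 t, E t &
       exists2 g, fun_deriv f (gamma t) g & enorm g = 1].
Proof.
move=> cF F0 F01 pF _ [G [oG dG GE]] _ Og Lg Eg.
have S : curve_setting gamma F E G by split.
have Ug : unit_speed_curve gamma by split.
(* [None] is the first move; [Some (n, a, b)] forces the members of
   [steep_at n a b] into a refinement. *)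
pose W (c : option (nat * rat * rat)) : set (('I_d -> R) -> R) :=
  if c is Some (n, a, b) then
    [set f | (exists a' b', refines gamma F G n a b a' b' f) \/
       exists2 r : R, 0 < r & forall h, Lip1 d h -> sup_ball d f r h ->
         ~ steep_at gamma F G n a b h]
  else [set f | exists a b, steep_at gamma F G 0 a b f].
have ballxx (f : ('I_d -> R) -> R) (r : R) : 0 < r -> sup_ball d f r f.
  by exists 0; split => // x _; rewrite subrr normr0.
have ball_half (f g h : ('I_d -> R) -> R) (r : R) :
    sup_ball d f (r / 2) g -> sup_ball d g (r / 2) h -> sup_ball d f r h.
  move=> [r1 [r1r fg]] [r2 [r2r gh]]; exists (r1 + r2); split; first lra.
  move=> x Cx; apply: le_trans (ler_distD (g x) _ _) _.
  by apply: lerD; [exact: fg|exact: gh].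
have oW c : open_in (@sup_ball R d) (Lip1 d) (W c).
  case: c => [[[n a] b]|] f Lf /=.
    case=> [[a' [b' ref]]|[r r0 no]].
      have [r r0 H] := refines_open Ug Lf ref.
      by exists r => // g Lg' fg; left; exists a', b'; exact: H.
    exists (r / 2); first by rewrite divr_gt0.
    move=> g Lg' fg; right; exists (r / 2); first by rewrite divr_gt0.
    by move=> h Lh gh; apply: no => //; exact: ball_half gh.
  move=> [a [b st]]; have [r r0 H] := steep_at_open Ug Lf st.
  by exists r => // g Lg' fg; exists a, b; exact: H.
have dW c : dense_in (@sup_ball R d) (Lip1 d) (W c).
  case: c => [[[n a] b]|] f Lf r r0; last first.
    by have [g [? ? ?]] := steep_at0_dense S F0 Lf r0; exists g.
  have r20 : 0 < r / 2 by rewrite divr_gt0.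
  (* Either functions steep on the interval occur near [f], and one of them can be refined, or [f]
     itself has a ball free of them. *)
  have [[h [Lh fh st]]|no] :=
      pselect (exists h, [/\ Lip1 d h, sup_ball d f (r / 2) h & steep_at gamma F G n a b h]).
    have [g [Lg' ref hg]] := refines_dense S Lh st r20.
    by exists g; split => //; [left|exact: ball_half hg].
  exists f; split => //; [right|exact: ballxx].
  by exists (r / 2) => // h Lh fh st; apply: no; exists h.
apply: (residual_in_countable (W := W)) => // [f r _|f Lf Wf]; first exact: ballxx.
have [a0 [b0 st0]] := Wf None.
(* When [f] is steep the second alternative of [W] fails, since [f] lies in each of its own
   balls. *)
have ex (c : nat * (rat * rat)) : exists ab', steep_at gamma F G c.1 c.2.1 c.2.2 f ->
    refines gamma F G c.1 c.2.1 c.2.2 ab'.1 ab'.2 f.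
  case: c => n [a b] /=; case: (Wf (Some (n, a, b))) => [[a' [b' ref]]|[r r0 no]].
    by exists (a', b').
  by exists (a, b) => st; case: (no f Lf (ballxx f r r0) st).
have [nx nxP] := choice ex.
pose s := fix s n := if n is m.+1 then nx (m, s m) else (a0, b0).
have st n : steep_at gamma F G n (s n).1 (s n).2 f.
  by elim: n => //= n IH; have [] := nxP (n, s n) IH.
apply: (@nested_slopes_fun_deriv R d gamma F E G f
  (fun n => ratr (s n).1) (fun n => ratr (s n).2)) => // n; first by have [] := st n.
by have [] := nxP (n, s n) (st n).
Qed.
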